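(* Let $K$ be a field, let $m,n\ge 1$, let $X$ be an $m\times n$ matrix of indeterminates, let $Y$ be the generic $n\times 1$ column matrix with entries $y_1,\dots,y_n$, and let $R$ be the polynomial algebra over $K$ in the indeterminates occurring in $X$ and $Y$. Suppose that one of the following holds: (i) $m=n$ and $X=(x_{ij})$ is generic or generic symmetric; (ii) $m=n+1$ and $X=(x_{ij})$ is generic. Then the ideal $I_1(XY)$ of $R$ is normally torsionfree.
   Context: ''Generic'' means that the entries $x_{ij}$ ($1\le i\le m$, $1\le j\le n$) of $X$ are distinct indeterminates over $K$. ''Generic symmetric'' (for $m=n$) means that $x_{ij}=x_{ji}$ and the $x_{ij}$ with $i\le j$ are distinct indeterminates. The $y_j$ are further distinct indeterminates. $I_1(XY)=\langle g_1,\dots,g_m\rangle$ with $g_i=\sum_{j=1}^n x_{ij}y_j$ is the ideal generated by the entries of $XY$. An ideal $I$ of a Noetherian ring $R$ is normally torsionfree if $\mathrm{Ass}(R/I)=\mathrm{Ass}(R/I^{k})$ for all $k\ge 1$. *)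

(* Defs.v *)
From HB Require Import structures.
From mathcomp Require Import all_boot all_order all_algebra.
From mathcomp Require Import mpoly.

Set Implicit Arguments.
Unset Strict Implicit.
Unset Printing Implicit Defensive.

Import GRing.Theory.
Local Open Scope ring_scope.

Section Ideals.
Variable R : comNzRingType.

(* Ideals are Prop-valued subsets: ring_quotient's idealr_closed is restricted
   to boolean (decidable) predicates and to proper ideals. *)
Definition is_ideal (I : R -> Prop) : Prop :=
  [/\ I 0, forall a b, I a -> I b -> I (a + b) & forall r a, I a -> I (r * a)].

Definition is_prime_ideal (P : R -> Prop) : Prop :=
  [/\ is_ideal P, ~ P 1 & forall a b, P (a * b) -> P a \/ P b].

Definition ideal_gen (G : R -> Prop) (x : R) : Prop :=
  exists s : seq (R * R),
    (forall p, p \in s -> G p.2) /\ x = \sum_(p <- s) p.1 * p.2.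

Definition ideal_mul (I J : R -> Prop) : R -> Prop :=
  ideal_gen (fun x => exists a b, [/\ I a, J b & x = a * b]).

Fixpoint ideal_pow (I : R -> Prop) (k : nat) : R -> Prop :=
  if k is l.+1 then ideal_mul I (ideal_pow I l) else fun=> True.

(* P \in Ass(R/I): P is a prime ideal and the annihilator of the class of some
   a in R/I, i.e. of the elements r with r * a in I. *)
Definition assoc_prime (I P : R -> Prop) : Prop :=
  is_prime_ideal P /\ exists a, forall r, P r <-> I (r * a).

Definition normally_torsionfree (I : R -> Prop) : Prop :=
  forall k, (0 < k)%N ->
  forall P, assoc_prime I P <-> assoc_prime (ideal_pow I k) P.

Definition I1 (p q : nat) (A : 'M[R]_(p, q)) : R -> Prop :=
  ideal_gen (fun x => exists i j, x = A i j).

End Ideals.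

(* Bijectivity of f says that the listed indeterminates are pairwise distinct
   and that {mpoly K[N]} has no others. *)
Definition generic (K : fieldType) (m n N : nat)
    (X : 'M[{mpoly K[N]}]_(m, n)) (Y : 'cV[{mpoly K[N]}]_n) : Prop :=
  exists f : 'I_m * 'I_n + 'I_n -> 'I_N,
    [/\ bijective f,
        forall i j, X i j = 'X_(f (inl (i, j)))
      & forall j, Y j 0 = 'X_(f (inr j))].

Definition generic_symmetric (K : fieldType) (n N : nat)
    (X : 'M[{mpoly K[N]}]_n) (Y : 'cV[{mpoly K[N]}]_n) : Prop :=
  exists f : {p : 'I_n * 'I_n | (p.1 <= p.2)%N} + 'I_n -> 'I_N,
    [/\ bijective f,
        X^T = X,
        forall p, X (val p).1 (val p).2 = 'X_(f (inl p))
      & forall j, Y j 0 = 'X_(f (inr j))].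

(* Main.v *)
Require Import Defs.
From HB Require Import structures.
From mathcomp Require Import all_boot all_order all_algebra.
From mathcomp Require Import mpoly ring.
From Stdlib Require Import Classical.

Set Implicit Arguments.
Unset Strict Implicit.
Unset Printing Implicit Defensive.

Import GRing.Theory.
Local Open Scope ring_scope.

(** Write [g_i = \sum_j x_ij y_j], [I = (g_1, ..., g_m)] and [(Y)] for the ideal
of the [y_j].

Deformation. Adjoin further indeterminates [z_1, ..., z_m, u] and put
[J' = (g_1 + z_1 u, ..., g_m + z_m u)]; the quotient by [J'] and its [u]-torsion is
the extended Rees algebra of [I].  If [F] is a form of degree [k] and
[F(g) = G(g)] with [G] a form of degree [k+1], then [u^k (F(z) + u G(z))] lies in
[J'] up to signs.  So once it is known that [u^k f \in J'] implies [w f \in J'],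
setting [u = 0] shows that every coefficient [c] of [F] satisfies [w c \in I].
This property of [w] ([form_torsion]) replaces all knowledge of the associated
graded ring.  But [J'] is again generated by the entries of a matrix times a
column, namely [(X | z)] times [(Y; u)], so what is required is the colon ideal
of such an ideal by one of the [y]'s.

Colon ideals. If [y_p f = \sum_i a_i g_i], setting [y_p = 0] yields a syzygy of the
same forms with one column fewer.  The last coefficient of a syzygy is governed by
a colon ideal with one row fewer, by looking at the top coefficient with respect
to an indeterminate that occurs in the last form only ([free_content]).  Both steps
together give inductions.  When there are at least as many columns as rows and
every diagonal entry [x_ii] is an indeterminate occurring nowhere else (generic
square and generic symmetric matrices), a [y] whose column is not among those
of the rows used is a nonzerodivisor ([form_ideal_y_regular]), so that [w = 1] has
[form_torsion].  For a generic [q x p] matrix, [I : y_p] is generated by [I] and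
the maximal minors of size [p] ([row_ideal_colon]), which are killed by [(Y)]
modulo [I] by Cramer; for [m = n + 1] this gives [form_torsion] for each [y_j]
([tall_form_torsion]).

Associated primes. If [w] has [form_torsion] and [w \notin P], then [P] is
associated to [I^k] if and only if it is associated to [I]
([assoc_prime_descend], [assoc_prime_ascend]).  With [w = 1] this settles the
square cases.  For [m = n + 1] it settles all primes not containing [(Y)].  A prime
[P] containing [(Y)] is associated to [I^k] only if it equals [(Y)]: an [f] of
[y]-order at least [k] with [(Y) f \subset I^k] already lies in [I^k]
([y_adic_colon]), and an [f] of smaller order is annihilated modulo [I^k] only by
elements of [(Y)].  Conversely [y_n^(k-1) D^k], with [D] a nonzero maximal minor,
has annihilator [(Y)] modulo [I^k]. *)

(** * Ideals spanned by finite families *)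

Section Span.
Variables (B : comNzRingType) (T : finType).

Definition span (P : pred T) (g : T -> B) (f : B) : Prop :=
  exists a : T -> B, f = \sum_(i | P i) a i * g i.

Lemma span_ideal P g : is_ideal (span P g).
Proof.
split=> [|_ _ [a ->] [b ->]|r _ [a ->]].
- by exists (fun=> 0); rewrite big1 // => i _; rewrite mul0r.
- by exists (fun i => a i + b i); rewrite -big_split; apply: eq_bigr => i _; rewrite mulrDl.
- by exists (fun i => r * a i); rewrite mulr_sumr; apply: eq_bigr => i _; rewrite mulrA.
Qed.

Lemma span_gen (P : pred T) g i : P i -> span P g (g i).
Proof.
move=> Pi; exists (fun j => (j == i)%:R).
rewrite (bigD1 i) //= eqxx mul1r big1 ?addr0 // => j /andP[_ /negPf ->].
by rewrite mul0r.
Qed.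

End Span.

Section IdealTheory.
Variable B : comNzRingType.
Implicit Types (J M : B -> Prop).

Lemma ideal_sum J (T : Type) (s : seq T) (P : pred T) (F : T -> B) :
  is_ideal J -> (forall i, P i -> J (F i)) -> J (\sum_(i <- s | P i) F i).
Proof. by case=> J0 JD _ JF; apply: big_ind. Qed.

Lemma ideal_mulr J a r : is_ideal J -> J a -> J (a * r).
Proof. by case=> _ _ JM Ja; rewrite mulrC; apply: JM. Qed.

Lemma ideal_mull J a r : is_ideal J -> J a -> J (r * a).
Proof. by case=> _ _ JM Ja; apply: JM. Qed.

Lemma ideal_opp J a : is_ideal J -> J a -> J (- a).
Proof. by case=> _ _ JM Ja; rewrite -mulN1r; apply: JM. Qed.

Lemma ideal_add J a b : is_ideal J -> J a -> J b -> J (a + b).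
Proof. by case=> _ JD _; apply: JD. Qed.

Lemma ideal_sub J a b : is_ideal J -> J a -> J b -> J (a - b).
Proof. by move=> hJ Ja Jb; apply: ideal_add => //; apply: ideal_opp. Qed.

Lemma span_min J (T : finType) (P : pred T) (g : T -> B) f :
  is_ideal J -> (forall i, P i -> J (g i)) -> span P g f -> J f.
Proof.
move=> hJ hg [a ->]; apply: ideal_sum => // i Pi.
by apply: ideal_mull => //; apply: hg.
Qed.

End IdealTheory.

(** * Free variables *)

Section FreeVariable.
Variable B : comNzRingType.

(** This holds when the ring is a polynomial ring in [v] over a subring that contains
[W], with [psi] writing an element as a polynomial in [v].  Stated for an abstract
ring, it carries over when further indeterminates are adjoined. *)
Definition free_over (v : B) (W : B -> Prop) : Prop :=
  exists psi : {rmorphism B -> {poly B}},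
    [/\ psi v = 'X, forall b, (psi b).[v] = b & forall w, W w -> psi w = w%:P].

Lemma free_overW v (W W' : B -> Prop) :
  (forall w, W' w -> W w) -> free_over v W -> free_over v W'.
Proof. by move=> sW [psi [h1 h2 h3]]; exists psi; split=> // w /sW /h3. Qed.

Lemma free_regular v W b : free_over v W -> v * b = 0 -> b = 0.
Proof.
case=> psi [psiv psiK _] vb0; rewrite -(psiK b).
suff ->: psi b = 0 by rewrite horner0.
apply/polyP => i; rewrite coef0.
have /(congr1 (fun p : {poly B} => p`_i.+1)) : psi (v * b) = 0.
  by rewrite vb0 rmorph0.
by rewrite rmorphM psiv coefXM coef0.
Qed.

Lemma free_kill v W : free_over v W ->
  exists sigma : {rmorphism B -> B},
    [/\ sigma v = 0, forall w, W w -> sigma w = w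
      & forall b, exists c, b = sigma b + v * c].
Proof.
case=> psi [psiv psiK psiW].
exists (horner_eval (0 : B) \o psi); split=> [|w /psiW|b] /=.
- by rewrite psiv horner_evalE hornerX.
- by move=> ->; rewrite horner_evalE hornerC.
rewrite horner_evalE -{1}(psiK b); elim/poly_ind: (psi b) => [|p c _].
  by exists 0; rewrite !horner0 mulr0 addr0.
by exists p.[v]; rewrite !hornerE; ring.
Qed.

Lemma span_free_coef (T : finType) (P : pred T) (g : T -> B)
    (psi : {rmorphism B -> {poly B}}) f k :
  (forall i, P i -> psi (g i) = (g i)%:P) -> span P g f -> span P g (psi f)`_k.
Proof.
move=> hg [a ->]; rewrite rmorph_sum coef_sum; exists (fun i => (psi (a i))`_k).
by apply: eq_bigr => i /hg psig; rewrite rmorphM psig coefMC.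
Qed.

(** The coefficients of [psi a] lie in [M] by descending induction: if the one of
degree [i.+1] does, its contribution through [g0] to the coefficient of degree
[i.+1] of [psi (a * (g0 + v * y))] lies in [J], hence so does the remaining
contribution, [y] times the coefficient of degree [i]. *)
Lemma free_content (J M : B -> Prop) (psi : {rmorphism B -> {poly B}}) g0 v y a :
  is_ideal J -> is_ideal M ->
  psi v = 'X -> (forall b, (psi b).[v] = b) ->
  psi g0 = g0%:P -> psi y = y%:P ->
  (forall f k, J f -> J (psi f)`_k) ->
  (forall c, J (c * y) -> M c) -> (forall c, M c -> J (c * g0)) ->
  J (a * (g0 + v * y)) -> M a.
Proof.
move=> hJ hM psiv psiK psig psiy Jpsi JM MJ Ja.
have step i : M (psi a)`_i.+1 -> M (psi a)`_i.
  move=> /MJ Mi; apply: JM.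
  have := Jpsi _ i.+1 Ja.
  rewrite rmorphM rmorphD rmorphM psiv psig psiy mulrDr coefD coefMC.
  rewrite mulrA coefMC coefMX /= => h.
  by have := ideal_sub hJ h Mi; rewrite addrC addKr.
have all_coef i : M (psi a)`_i.
  have big : forall d, M (psi a)`_(size (psi a) - d)%N.
    elim=> [|d IHd]; first by rewrite subn0 nth_default //; case: hM.
    have [le_d|lt_d] := leqP (size (psi a)) d.
      have /eqP e0 : (size (psi a) - d == 0)%N by rewrite subn_eq0.
      by rewrite subnS e0 /= -e0.
    by apply: step; rewrite subnSK.
  have [le_i|lt_i] := leqP (size (psi a)) i; first by rewrite nth_default //; case: hM.
  by rewrite -(subKn (ltnW lt_i)); apply: big.
rewrite -(psiK a) horner_coef; apply: ideal_sum => // i _.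
exact: ideal_mulr.
Qed.

End FreeVariable.

(** * Matrices with free diagonal entries *)

Section DiagonalVariables.
Variables (B : comNzRingType) (T : finType) (x : T -> T -> B) (y : T -> B).
Variable L0 : {set T}.

Definition linear_form (C : {set T}) (l : T) : B := \sum_(j in C) x l j * y j.

Definition form_ideal (L C : {set T}) : B -> Prop :=
  span (fun k => k \in L) (linear_form C).

(* The entry [x i i] must differ from all other entries of the rows in [L0], but
   the other entries may coincide among themselves, as in a symmetric matrix. *)
Hypothesis free_diag : forall i, i \in L0 ->
  free_over (x i i) (fun w => (exists j, w = y j) \/
    exists k j, [/\ k \in L0, (k, j) != (i, i) & w = x k j]).

Hypothesis free_y : forall i,
  free_over (y i) (fun w => (exists2 j, j != i & w = y j) \/
    exists k j, k \in L0 /\ w = x k j).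

(** A syzygy [a] of the forms on the columns [C] is, after adding column [j], a
relation whose value is [y j] times the sum below.  That this sum lies in the ideal
is all that is used about syzygies, and it is stable under induction, in contrast
to an explicit list of generators of the syzygies. *)
Definition syzygy_transfer (d : nat) : Prop :=
  forall (L C : {set T}) (a : T -> B) (j : T),
  #|L| = d -> L \subset L0 -> L \subset C -> j \notin C ->
  \sum_(l in L) a l * linear_form C l = 0 ->
  form_ideal L (j |: C) (\sum_(l in L) a l * x l j).

Lemma linear_formU1 (C : {set T}) j l : j \notin C ->
  linear_form (j |: C) l = x l j * y j + linear_form C l.
Proof. by move=> jC; rewrite /linear_form big_setU1. Qed.

(** In [y j * f = \sum a l * g l] replace each [a l] by its value at [y j = 0] plus a
multiple of [y j]; the values at [y j = 0] form a syzygy on the columns [C], and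
[y j] can be cancelled. *)
Lemma y_regular_of_transfer d (L C : {set T}) j f :
  syzygy_transfer d -> #|L| = d -> L \subset L0 -> L \subset C -> j \notin C ->
  form_ideal L (j |: C) (y j * f) -> form_ideal L (j |: C) f.
Proof.
move=> Wd cardL L0L LC jC [a def_a].
have [sigma [sigma0 sigmaK sigmaE]] := free_kill (free_y j).
have sigma_x k i : k \in L -> sigma (x k i) = x k i.
  by move=> kL; apply: sigmaK; right; exists k, i; rewrite (subsetP L0L).
have sigma_form l : l \in L -> sigma (linear_form (j |: C) l) = linear_form C l.
  move=> lL; rewrite linear_formU1 // rmorphD rmorphM sigma0 mulr0 add0r.
  rewrite /linear_form rmorph_sum /=; apply: eq_bigr => i iC; rewrite rmorphM sigma_x //.
  rewrite (sigmaK (y i)) //; left; exists i => //.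
  by apply: contraNneq jC => <-.
have syz : \sum_(l in L) sigma (a l) * linear_form C l = 0.
  have := congr1 sigma def_a; rewrite rmorphM sigma0 mul0r rmorph_sum /= => h; rewrite [RHS]h.
  by apply: eq_bigr => l lL; rewrite rmorphM sigma_form.
have /fin_all_exists [b bE] : forall l, exists c, a l = sigma (a l) + y j * c by [].
have -> : f = \sum_(l in L) sigma (a l) * x l j
              + \sum_(l in L) b l * linear_form (j |: C) l.
  apply/eqP; rewrite -subr_eq0; apply/eqP.
  apply: (free_regular (free_y j)); rewrite mulrBr def_a.
  transitivity (\sum_(l in L) sigma (a l) * linear_form C l); last exact: syz.
  rewrite mulrDr !mulr_sumr -big_split -sumrB /=; apply: eq_bigr => l lL.
  by rewrite {1}(bE l) linear_formU1 //; ring.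
apply: ideal_add; first exact: span_ideal.
  exact: Wd.
by exists b.
Qed.

(** By induction on the number of rows.  Given a syzygy and a row [i], the
indeterminate [x i i] occurs in no other form, so [a i] lies in the ideal of the
other forms as soon as [y i] is a nonzerodivisor modulo it; this holds by induction
because row [i] has been removed from the rows but column [i] is still present.
Subtracting Koszul relations makes [a i] vanish. *)
Lemma form_ideal_y_regular (L C : {set T}) j f :
  L \subset L0 -> L \subset C -> j \notin C ->
  form_ideal L (j |: C) (y j * f) -> form_ideal L (j |: C) f.
Proof.
move=> L0L LC jC; apply: (@y_regular_of_transfer #|L|) => //.
elim: {L C j f L0L LC jC}#|L| => [|d IHd] L C a j cardL L0L LC jC syz.
  by exists (fun=> 0); rewrite (cards0_eq cardL) !big_set0.
have [i iL] : exists i, i \in L by apply/set0Pn; rewrite -card_gt0 cardL.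
pose L' := L :\ i; pose C' := C :\ i.
have iC : i \in C by rewrite (subsetP LC).
have defC : i |: C' = C by rewrite setD1K.
have cardL' : #|L'| = d by move: cardL; rewrite (cardsD1 i) iL => -[].
have L'L : L' \subset L by rewrite subD1set.
have L0L' : L' \subset L0 by rewrite (subset_trans L'L).
have L'C : L' \subset C by rewrite (subset_trans L'L).
have L'C' : L' \subset C' by rewrite setSD.
have iC' : i \notin C' by rewrite !inE eqxx.
have i0 : i \in L0 by rewrite (subsetP L0L).
have big_split_i (F : T -> B) : \sum_(l in L) F l = F i + \sum_(l in L') F l.
  by rewrite (big_setD1 i).
have hJ := span_ideal (fun k => k \in L') (linear_form C).
have [psi [psiv psiK psiW]] := free_diag i0.
have psi_y k : psi (y k) = (y k)%:P by apply: psiW; left; exists k.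
have psi_x k l : k \in L0 -> (k, l) != (i, i) -> psi (x k l) = (x k l)%:P.
  by move=> k0 kl; apply: psiW; right; exists k, l.
have [c def_ai] : form_ideal L' C (a i).
  apply: (@free_content B (form_ideal L' C) (form_ideal L' C) psi
    (linear_form C' i) (x i i) (y i)) => //.
  - rewrite /linear_form !rmorph_sum /=; apply: eq_bigr => l.
    rewrite !inE => /andP[li _]; rewrite rmorphM psi_y psi_x ?polyCM //.
    by apply: contraNneq li => -[->].
  - move=> f k; apply: span_free_coef => l lL'; rewrite /linear_form !rmorph_sum /=.
    apply: eq_bigr => r _; rewrite rmorphM psi_y psi_x ?polyCM //.
      exact: (subsetP L0L').
    move: lL'; rewrite !inE => /andP[li _].
    by apply: contraNneq li => -[->].
  - move=> e; rewrite mulrC -defC.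
    exact: (@y_regular_of_transfer d).
  - by move=> e; apply: ideal_mulr.
  have -> : linear_form C' i + x i i * y i = linear_form C i.
    by rewrite -[in RHS]defC linear_formU1 // addrC.
  move: syz; rewrite big_split_i => /eqP; rewrite addr_eq0 => /eqP ->.
  by apply: ideal_opp => //; exists a.
(* Subtract the Koszul relations between row [i] and the rows [k], with
   coefficients [c k], to cancel [a i]. *)
pose a' k := a k + c k * linear_form C i.
have syz' : \sum_(k in L') a' k * linear_form C k = 0.
  rewrite -[RHS]syz big_split_i def_ai mulr_suml -big_split /=.
  by apply: eq_bigr => k _; rewrite /a'; ring.
have hJ1 := span_ideal (fun k => k \in L) (linear_form (j |: C)).
have -> : \sum_(l in L) a l * x l j = \sum_(k in L') a' k * x k j
  + \sum_(k in L') c k * (x i j * linear_form (j |: C) k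
                          - x k j * linear_form (j |: C) i).
  rewrite big_split_i def_ai mulr_suml -!big_split /=.
  by apply: eq_bigr => k _; rewrite /a' !linear_formU1 //; ring.
apply: ideal_add => //.
  apply: (@span_min _ _ _ (fun k => k \in L') (linear_form (j |: C))) => //.
    by move=> k /(subsetP L'L) kL; apply: span_gen.
  exact: IHd.
apply: ideal_sum => // k /(subsetP L'L) kL.
by apply: ideal_mull => //; apply: ideal_sub => //;
  apply: ideal_mull => //; apply: span_gen.
Qed.

End DiagonalVariables.

(** * Generic matrices and their maximal minors *)

Section GenericMinors.
Variables (B : comNzRingType) (x : nat -> nat -> B) (y : nat -> B) (m n : nat).

Definition row_form (p i : nat) : B := \sum_(j < p) x i j * y j.

Definition row_ideal (q p : nat) : B -> Prop :=
  span predT (fun i : 'I_q => row_form p i).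

(** Rows are selected by arbitrary functions: a repeated row only contributes a
vanishing determinant, and for [p = 0] the empty selection contributes [1]. *)
Definition minor_gen (q p : nat) (t : 'I_q + {ffun 'I_p -> 'I_q}) : B :=
  match t with
  | inl i => row_form p i
  | inr s => \det (\matrix_(l < p, j < p) x (s l) j)
  end.

Definition minor_ideal (q p : nat) : B -> Prop := span predT (@minor_gen q p).

Lemma row_formS p i : row_form p.+1 i = row_form p i + x i p * y p.
Proof. by rewrite /row_form big_ord_recr. Qed.

Lemma row_sub_minor q p f : row_ideal q p f -> minor_ideal q p f.
Proof.
apply: span_min => [|i _]; first exact: span_ideal.
exact: (@span_gen _ _ predT (@minor_gen q p) (inl i)).
Qed.

Lemma minor_ideal_mono q p f : minor_ideal q p f -> minor_ideal q.+1 p f.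
Proof.
apply: span_min => [|[i|s] _]; first exact: span_ideal.
  exact: (@span_gen _ _ predT (@minor_gen q.+1 p) (inl (widen_ord (leqnSn q) i))).
have := @span_gen _ _ predT (@minor_gen q.+1 p)
  (inr [ffun l => widen_ord (leqnSn q) (s l)]) isT.
congr (minor_ideal _ _ _); rewrite /=; congr (\det _).
by apply/matrixP => l j; rewrite !mxE ffunE.
Qed.

(** Cramer's rule, from [adj A * (A * Y) = det A * Y]. *)
Lemma minor_cramer (p : nat) (s : 'I_p -> nat) (j : 'I_p) :
  exists d : 'I_p -> B,
    \det (\matrix_(l < p, j < p) x (s l) j) * y j = \sum_l d l * row_form p (s l).
Proof.
set A := \matrix_(l, j) _; exists (fun l => (\adj A) j l).
have -> : \det A * y j = ((\adj A *m A) *m \col_j y j) j 0.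
  by rewrite mul_adj_mx mul_scalar_mx !mxE.
rewrite -mulmxA mxE; apply: eq_bigr => l _; congr (_ * _).
by rewrite mxE; apply: eq_bigr => k _; rewrite !mxE.
Qed.

Lemma minor_ideal_cramer q p c (j : nat) :
  (j < p)%N -> minor_ideal q p c -> row_ideal q p (c * y j).
Proof.
move=> lt_jp [a ->]; have hI := span_ideal predT (fun i : 'I_q => row_form p i).
rewrite mulr_suml; apply: ideal_sum => // -[i|s] _ /=.
  rewrite mulrAC; apply: ideal_mull => //.
  exact: (@span_gen _ _ predT (fun i : 'I_q => row_form p i) i).
rewrite -mulrA; apply: ideal_mull => //.
have [d ->] := minor_cramer (fun l => s l) (Ordinal lt_jp).
apply: ideal_sum => // l _; apply: ideal_mull => //.
exact: (@span_gen _ _ predT (fun i : 'I_q => row_form p i) (s l)).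
Qed.

(** The rows [s] followed by row [q], restricted to the first [p] columns, with one
more column [t]. *)
Definition border (p : nat) (s : 'I_p -> nat) (q : nat) (t : nat -> B) : 'M[B]_p.+1 :=
  \matrix_(l, j) let r := if unlift ord_max l is Some l' then s l' else q in
                 if unlift ord_max j is Some j' then x r j' else t r.

Lemma border_expand (p : nat) (s : 'I_p -> nat) (q : nat) :
  exists d : 'I_p -> B, forall t : nat -> B,
    \det (border s q t) =
      t q * \det (\matrix_(l < p, j < p) x (s l) j) - \sum_l d l * t (s l).
Proof.
exists (fun l => - cofactor (border s q (fun=> 0)) (lift ord_max l) ord_max) => t.
have cof l : cofactor (border s q t) l ord_max
           = cofactor (border s q (fun=> 0)) l ord_max.
  rewrite /cofactor; congr (_ * \det _); apply/matrixP => i j.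
  by rewrite !mxE liftK.
rewrite (expand_det_col _ ord_max) (bigD1_ord ord_max) //= addrC -sumrN addrC.
congr (_ + _).
  rewrite mxE unlift_none; congr (_ * _).
  rewrite /cofactor exprD -expr2 sqrr_sign mul1r; congr (\det _).
  by apply/matrixP => i j; rewrite !mxE !liftK.
by apply: eq_bigr => l _; rewrite cof mxE liftK unlift_none mulNr opprK mulrC.
Qed.

(** Both identities expand a bordered determinant along its last column.  The
column of the forms [row_form p] is a combination of the first [p] columns, so its
determinant vanishes: this is a syzygy of the forms.  Evaluated on column [p]
instead, the same syzygy yields a minor of size [p.+1]. *)
Lemma minor_relation (p : nat) (s : 'I_p -> nat) (q : nat) :
  let D := \det (\matrix_(l < p, j < p) x (s l) j) in
  exists d : 'I_p -> B,
    row_form p q * D = \sum_l d l * row_form p (s l) /\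
    x q p * D - \sum_l d l * x (s l) p = \det (border s q (fun i => x i p)).
Proof.
move=> D; have [d dE] := border_expand s q; exists d; split; last by rewrite dE.
have col0 (j : 'I_p) : \det (border s q (fun i => x i j)) = 0.
  rewrite -det_tr; apply: (@determinant_alternate _ _ _ (lift ord_max j) ord_max).
    by rewrite eq_sym neq_lift.
  by move=> l; rewrite !mxE liftK unlift_none.
apply/eqP; rewrite -subr_eq0 -dE; apply/eqP.
transitivity (\sum_(j < p) \det (border s q (fun i => x i j)) * y j); last first.
  by rewrite big1 // => j _; rewrite col0 mul0r.
rewrite dE -/D /row_form mulr_suml.
under [in RHS]eq_bigr do rewrite dE mulrBl -/D.
rewrite sumrB; congr (_ - _); first by apply: eq_bigr => j _; rewrite mulrAC.
under eq_bigr do rewrite mulr_sumr.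
rewrite exchange_big /=; apply: eq_bigr => j _.
by rewrite mulr_suml; apply: eq_bigr => l _; rewrite mulrA.
Qed.

Lemma border_minor q p (s : {ffun 'I_p -> 'I_q}) :
  minor_ideal q.+1 p.+1 (\det (border (fun l => s l) q (fun i => x i p))).
Proof.
pose s' : {ffun 'I_p.+1 -> 'I_q.+1} :=
  [ffun l => if unlift ord_max l is Some l' then widen_ord (leqnSn q) (s l')
             else ord_max].
have := @span_gen _ _ predT (@minor_gen q.+1 p.+1) (inr s') isT.
congr (minor_ideal _ _ _); congr (\det _); apply/matrixP => l j; rewrite !mxE ffunE /=.
have -> : forall o : option 'I_p,
    nat_of_ord (if o is Some l' then widen_ord (leqnSn q) (s l') else ord_max)
   = if o is Some l' then s l' : nat else q by case.
by case: (unliftP ord_max j) => [j'|] ->; rewrite ?lift_max.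
Qed.

(* The last column need not consist of indeterminates: in the application its
   entries are the deformation parameters. *)
Hypothesis free_x : forall i j, (i < m)%N -> (j.+1 < n)%N ->
  free_over (x i j) (fun w => (exists2 l, (l < n)%N & w = y l) \/
    exists k l, [/\ (k < m)%N, (l < n)%N, (k, l) != (i, j) & w = x k l]).

Hypothesis free_y : forall j, (j < n)%N ->
  free_over (y j) (fun w => (exists l, [/\ (l < n)%N, l != j & w = y l]) \/
    exists k l, [/\ (k < m)%N, (l < n)%N & w = x k l]).

(** The counterpart of [syzygy_transfer] without a bound on the number of rows: the
minors of size [p.+1] appear on the right. *)
Definition column_transfer (q p : nat) : Prop :=
  forall a : 'I_q -> B, \sum_i a i * row_form p i = 0 ->
  minor_ideal q p.+1 (\sum_i a i * x i p).

Lemma colon_of_transfer q p f : (q <= m)%N -> (p < n)%N -> column_transfer q p ->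
  row_ideal q p.+1 (y p * f) -> minor_ideal q p.+1 f.
Proof.
move=> le_qm lt_pn Wqp [a def_a].
have [sigma [sigma0 sigmaK sigmaE]] := free_kill (free_y lt_pn).
have sigma_form (i : 'I_q) : sigma (row_form p.+1 i) = row_form p i.
  have lt_im : (i < m)%N by rewrite (leq_trans (ltn_ord i)).
  rewrite row_formS rmorphD rmorphM sigma0 mulr0 addr0 /row_form rmorph_sum /=.
  apply: eq_bigr => j _; have lt_jn : (j < n)%N by rewrite (ltn_trans (ltn_ord j)).
  rewrite rmorphM (sigmaK (x i j)); last by right; exists i, j.
  by rewrite (sigmaK (y j)) //; left; exists j; rewrite lt_jn neq_ltn ltn_ord.
have syz : \sum_i sigma (a i) * row_form p i = 0.
  have := congr1 sigma def_a; rewrite rmorphM sigma0 mul0r rmorph_sum /= => h.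
  by rewrite [RHS]h; apply: eq_bigr => l _; rewrite rmorphM sigma_form.
have /fin_all_exists [b bE] : forall i, exists c, a i = sigma (a i) + y p * c by [].
have -> : f = \sum_i sigma (a i) * x i p + \sum_i b i * row_form p.+1 i.
  apply/eqP; rewrite -subr_eq0; apply/eqP.
  apply: (free_regular (free_y lt_pn)); rewrite mulrBr def_a.
  transitivity (\sum_i sigma (a i) * row_form p i); last exact: syz.
  rewrite mulrDr !mulr_sumr -big_split -sumrB /=; apply: eq_bigr => l _.
  by rewrite {1}(bE l) row_formS //; ring.
apply: ideal_add; first exact: span_ideal.
  exact: Wqp.
by apply: row_sub_minor; exists b.
Qed.

(** The coefficient of the last row lies in the ideal of the first [q] forms and the
minors of size [p].  Koszul relations remove its part in the forms, the relations of
[minor_relation] remove its part in the minors, and what is left is a syzygy of the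
first [q] forms.  The relations removed contribute forms, respectively minors of
size [p.+1]. *)
Lemma transfer_of_colon q p : (q < m)%N ->
  (forall a, row_ideal q p (a * row_form p q) -> minor_ideal q p a) ->
  column_transfer q p -> column_transfer q.+1 p.
Proof.
move=> lt_qm colon IHq a syz.
have hI := span_ideal predT (fun i : 'I_q => row_form p i).
have hM := span_ideal predT (@minor_gen q.+1 p.+1).
have lastE (F : nat -> B) (b : 'I_q.+1 -> B) : \sum_i b i * F i
    = \sum_(i < q) b (widen_ord (leqnSn q) i) * F i + b ord_max * F q.
  by rewrite big_ord_recr.
have [c def_c] : minor_ideal q p (a ord_max).
  apply: colon; move: syz; rewrite (lastE (row_form p)) addrC => /eqP.
  rewrite addr_eq0 => /eqP ->; apply: ideal_opp => //.
  by exists (fun i => a (widen_ord (leqnSn q) i)).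
have /fin_all_exists [d dE] : forall s : {ffun 'I_p -> 'I_q}, exists d : 'I_p -> B,
    row_form p q * @minor_gen q p (inr s) = \sum_l d l * row_form p (s l) /\
    x q p * @minor_gen q p (inr s) - \sum_l d l * x (s l) p
      = \det (border (fun l => s l) q (fun i => x i p)).
  by move=> s; apply: minor_relation.
(* The coefficients of the first [q] rows after the Koszul relations, with
   coefficients [c (inl i)], and the relations [d s], with coefficients
   [c (inr s)], have cancelled the coefficient of row [q]. *)
pose a' (i : 'I_q) := a (widen_ord (leqnSn q) i) + c (inl i) * row_form p q
  + \sum_(s : {ffun 'I_p -> 'I_q}) c (inr s) * \sum_(l | s l == i) d s l.
have a'E (F : nat -> B) : \sum_i a' i * F i
  = \sum_(i < q) a (widen_ord (leqnSn q) i) * F i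
    + \sum_(i < q) c (inl i) * (row_form p q * F i)
    + \sum_(s : {ffun 'I_p -> 'I_q}) c (inr s) * \sum_l d s l * F (s l).
  rewrite /a'; under eq_bigr do rewrite !mulrDl -mulrA.
  rewrite !big_split /=; congr (_ + _).
  under eq_bigr do rewrite mulr_suml.
  rewrite exchange_big /=; apply: eq_bigr => s _.
  under eq_bigr do rewrite -mulrA.
  rewrite -mulr_sumr (partition_big s predT) //=; congr (_ * _).
  by apply: eq_bigr => i _; rewrite mulr_suml; apply: eq_bigr => l /eqP ->.
have a_last : a ord_max = \sum_(i < q) c (inl i) * row_form p i
    + \sum_(s : {ffun 'I_p -> 'I_q}) c (inr s) * @minor_gen q p (inr s).
  by rewrite def_c big_sumType.
have syz' : \sum_i a' i * row_form p i = 0.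
  rewrite -[RHS]syz (lastE (row_form p)) a'E a_last mulrDl addrA !mulr_suml.
  congr (_ + _ + _); apply: eq_bigr => s _.
    by ring.
  by have [<- _] := dE s; ring.
have -> : \sum_i a i * x i p = \sum_i a' i * x i p
  + \sum_(i < q) c (inl i) * (x q p * row_form p.+1 i - x i p * row_form p.+1 q)
  + \sum_(s : {ffun 'I_p -> 'I_q}) c (inr s) * \det (border (fun l => s l) q (fun i => x i p)).
  rewrite (lastE (fun i => x i p)) (a'E (fun i => x i p)) a_last mulrDl !mulr_suml.
  have -> : \sum_(i < q) c (inl i) * (x q p * row_form p.+1 i - x i p * row_form p.+1 q)
    = \sum_(i < q) c (inl i) * row_form p i * x q p
      - \sum_(i < q) c (inl i) * (row_form p q * x i p).
    by rewrite -sumrB; apply: eq_bigr => i _; rewrite !row_formS; ring.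
  have -> : \sum_(s : {ffun 'I_p -> 'I_q})
        c (inr s) * \det (border (fun l => s l) q (fun i => x i p))
    = \sum_(s : {ffun 'I_p -> 'I_q}) c (inr s) * @minor_gen q p (inr s) * x q p
      - \sum_(s : {ffun 'I_p -> 'I_q}) c (inr s) * \sum_l d s l * x (s l) p.
    by rewrite -sumrB; apply: eq_bigr => s _; have [_ <-] := dE s; ring.
  by ring.
apply: ideal_add => //; first apply: ideal_add => //.
- exact/minor_ideal_mono/IHq.
- apply: ideal_sum => // i _; apply: ideal_mull => //.
  apply: ideal_sub => //; apply: ideal_mull => //.
    exact: (@span_gen _ _ predT (@minor_gen q.+1 p.+1) (inl (widen_ord (leqnSn q) i))).
  exact: (@span_gen _ _ predT (@minor_gen q.+1 p.+1) (inl ord_max)).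
- by apply: ideal_sum => // s _; apply: ideal_mull => //; apply: border_minor.
Qed.

(** Double induction on columns and rows.  For [p > 0] the colon condition of
[transfer_of_colon] follows from [free_content] applied to [x q (p-1)], which occurs
in row [q] only, together with the colon ideal by [y (p-1)], known by induction. *)
Lemma column_transferP p q : (q <= m)%N -> (p < n)%N -> column_transfer q p.
Proof.
elim: p q => [|p IHp]; elim=> [|q IHq] lt_qm lt_pn.
- by move=> a _; exists (fun=> 0); rewrite big_ord0 big1 // => i _; rewrite mul0r.
- apply: transfer_of_colon => //; last by apply: IHq => //; apply: ltnW.
  move=> a _.
  have := @span_gen _ _ predT (@minor_gen q 0) (inr (ffun0 (card_ord 0))) isT.
  rewrite /= det_mx00 => one_in; rewrite -[a]mulr1.
  by apply: ideal_mull => //; apply: span_ideal.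
- by move=> a _; exists (fun=> 0); rewrite big_ord0 big1 // => i _; rewrite mul0r.
have le_qm := ltnW lt_qm; have lt_pn' := ltnW lt_pn.
apply: transfer_of_colon => //; last exact: IHq.
move=> a; have [psi [psiv psiK psiW]] := free_x lt_qm lt_pn.
have psi_y k : (k < n)%N -> psi (y k) = (y k)%:P by move=> lt_k; apply: psiW; left; exists k.
have psi_x k l : (k < m)%N -> (l < n)%N -> (k, l) != (q, p) -> psi (x k l) = (x k l)%:P.
  by move=> lt_k lt_l ne; apply: psiW; right; exists k, l.
have hI := span_ideal predT (fun i : 'I_q => row_form p.+1 i).
rewrite row_formS; apply: (@free_content B (row_ideal q p.+1) (minor_ideal q p.+1)
  psi _ (x q p) (y p)) => //.
- exact: span_ideal.
- rewrite /row_form !rmorph_sum /=; apply: eq_bigr => l _.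
  have lt_ln : (l < n)%N by rewrite (ltn_trans (ltn_ord l)).
  rewrite rmorphM psi_y // psi_x ?polyCM //.
  by apply/eqP => -[e]; have := ltn_ord l; rewrite e ltnn.
- exact: psi_y.
- move=> f k; apply: span_free_coef => i _; rewrite /row_form !rmorph_sum /=.
  apply: eq_bigr => l _; have lt_ln : (l < n)%N by rewrite (leq_trans (ltn_ord l)).
  rewrite rmorphM psi_y // psi_x ?polyCM //.
    by rewrite (ltn_trans (ltn_ord i)).
  by apply/eqP => -[e]; have := ltn_ord i; rewrite e ltnn.
- move=> c; rewrite mulrC; apply: colon_of_transfer => //.
  exact: IHp.
- move=> c Mc; rewrite /row_form mulr_sumr; apply: ideal_sum => // l _.
  rewrite mulrCA; apply: ideal_mull => //.
  by apply: minor_ideal_cramer => //; rewrite ltnS ltnW.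
Qed.

(** For a generic matrix the colon ideal by the last [y] is generated by the forms
and the maximal minors. *)
Lemma row_ideal_colon q p f : (q <= m)%N -> (p < n)%N ->
  row_ideal q p.+1 (y p * f) -> minor_ideal q p.+1 f.
Proof. by move=> le_qm lt_pn; apply: colon_of_transfer => //; apply: column_transferP. Qed.

Definition y_ideal (k : nat) : B -> Prop := span predT (fun j : 'I_k => y j).

Lemma y_retraction k : (k <= n)%N ->
  exists sigma : {rmorphism B -> B},
    [/\ forall j, (j < k)%N -> sigma (y j) = 0,
        forall j, (k <= j < n)%N -> sigma (y j) = y j,
        forall i j, (i < m)%N -> (j < n)%N -> sigma (x i j) = x i j
      & forall b, y_ideal k (b - sigma b)].
Proof.
elim: k => [|k IHk] lt_kn.
  exists idfun; split=> // b; rewrite subrr.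
  by case: (span_ideal predT (fun j : 'I_0 => y j)).
have [sigma [s0 sy sx sE]] := IHk (ltnW lt_kn).
have [tau [t0 tW tE]] := free_kill (free_y lt_kn).
have hY := span_ideal predT (fun j : 'I_k.+1 => y j).
exists (tau \o sigma); split=> [j|j /andP[lt_kj lt_jn]|i j lt_im lt_jn|b] /=.
- rewrite ltnS leq_eqVlt => /predU1P[->|/s0 ->]; last by rewrite rmorph0.
  by rewrite sy // leqnn.
- rewrite sy ?lt_jn ?andbT 1?ltnW // tW //.
  by left; exists j; rewrite lt_jn neq_ltn lt_kj orbT.
- by rewrite sx // tW //; right; exists i, j.
have [c cE] := tE (sigma b).
have -> : b - tau (sigma b) = (b - sigma b) + c * y k.
  by rewrite [in RHS]cE; ring.
apply: ideal_add => //.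
  apply: span_min (sE b) => // j _.
  exact: (@span_gen _ _ predT (fun j : 'I_k.+1 => y j) (widen_ord (leqnSn k) j)).
apply: ideal_mull => //.
exact: (@span_gen _ _ predT (fun j : 'I_k.+1 => y j) ord_max).
Qed.

(** Write [f] in terms of forms and minors.  Since the minors do not involve the
[y]'s, setting all [y]'s to [0] shows that the coefficients of the minors may be
taken in the ideal of the [y]'s, which multiplies the minors into the row ideal. *)
Lemma y_ideal_colon q p f : (q <= m)%N -> (p < n)%N -> y_ideal p.+1 f ->
  row_ideal q p.+1 (y p * f) -> row_ideal q p.+1 f.
Proof.
move=> le_qm lt_pn Yf /(row_ideal_colon le_qm lt_pn)[a].
have [sigma [s0 _ sx sE]] := y_retraction lt_pn.
have hI := span_ideal predT (fun i : 'I_q => row_form p.+1 i).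
have s_x (i : 'I_q) (j : 'I_p.+1) : sigma (x i j) = x i j.
  by rewrite sx // ?(leq_trans (ltn_ord _)).
have s_minor (s : {ffun 'I_p.+1 -> 'I_q}) :
    sigma (@minor_gen q p.+1 (inr s)) = @minor_gen q p.+1 (inr s).
  rewrite /= -det_map_mx; congr (\det _); apply/matrixP => l j.
  by rewrite !mxE s_x.
have s_form (i : 'I_q) : sigma (row_form p.+1 i) = 0.
  by rewrite /row_form rmorph_sum big1 // => j _; rewrite rmorphM s0 // mulr0.
have s_f : sigma f = 0.
  have [c ->] := Yf; rewrite rmorph_sum big1 // => j _.
  by rewrite rmorphM s0 // mulr0.
rewrite big_sumType /= => def_f.
have minors0 : \sum_(s : {ffun 'I_p.+1 -> 'I_q})
    sigma (a (inr s)) * @minor_gen q p.+1 (inr s) = 0.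
  move: s_f; rewrite def_f rmorphD !rmorph_sum /= [X in X + _]big1 ?add0r => [h|i _].
    rewrite -[RHS]h; apply: eq_bigr => s _; rewrite rmorphM; congr (_ * _).
    exact/esym/s_minor.
  by rewrite rmorphM s_form mulr0.
rewrite def_f; apply: ideal_add => //.
  by exists (fun i => a (inl i)).
set S := \sum_(s : {ffun _ -> _}) _.
have -> : S = \sum_(s : {ffun 'I_p.+1 -> 'I_q})
    (a (inr s) - sigma (a (inr s))) * @minor_gen q p.+1 (inr s).
  under [in RHS]eq_bigr do rewrite mulrBl.
  by rewrite sumrB minors0 subr0.
apply: ideal_sum => // s _.
have [c ->] := sE (a (inr s)); rewrite mulr_suml.
apply: ideal_sum => // j _; rewrite -mulrA; apply: ideal_mull => //.
rewrite mulrC; apply: minor_ideal_cramer => //.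
exact: (@span_gen _ _ predT (@minor_gen q p.+1) (inr s)).
Qed.

(** A second factor [y p] can be cancelled by [y_ideal_colon], so the torsion with
respect to powers of [y p] is that of [row_ideal_colon], and Cramer applies. *)
Lemma row_ideal_saturation q p k f : (q <= m)%N -> (p < n)%N ->
  row_ideal q p.+1 (y p ^+ k * f) ->
  forall j, (j <= p)%N -> row_ideal q p.+1 (y j * f).
Proof.
move=> le_qm lt_pn; have hI := span_ideal predT (fun i : 'I_q => row_form p.+1 i).
elim: k f => [|k IHk] f; first by rewrite expr0 mul1r => If j _; apply: ideal_mull.
rewrite exprSr -mulrA => /IHk /(_ p (leqnn p)) Iyyf j le_jp.
rewrite mulrC; apply: minor_ideal_cramer => //.
apply: row_ideal_colon => //; apply: y_ideal_colon => //.
exists (fun i => (i == ord_max)%:R * f).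
rewrite (bigD1 ord_max) //= eqxx mul1r big1 ?addr0 ?[f * _]mulrC // => i /negPf ->.
by rewrite !mul0r.
Qed.

End GenericMinors.

(** * Free variables in polynomial rings *)

Lemma poly_hom_eq (A C : comNzRingType) (f g : {rmorphism {poly A} -> C}) :
  (forall c, f c%:P = g c%:P) -> f 'X = g 'X -> f =1 g.
Proof.
move=> fgC fgX; elim/poly_ind => [|p c IHp]; first by rewrite !rmorph0.
by rewrite !rmorphD !rmorphM IHp fgC fgX.
Qed.

Lemma mpoly_hom_eq (N : nat) (A C : comNzRingType)
    (f g : {rmorphism {mpoly A[N]} -> C}) :
  (forall c, f c%:MP = g c%:MP) -> (forall i, f 'X_i = g 'X_i) -> f =1 g.
Proof.
move=> fgC fgX; elim/mpolyind => [|c m p _ _ IHp]; first by rewrite !rmorph0.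
rewrite !rmorphD IHp -mul_mpolyC !rmorphM fgC; congr (_ * _ + _).
by rewrite mpolyXE_id !rmorph_prod; apply: eq_bigr => i _; rewrite !rmorphXn fgX.
Qed.

Lemma free_mpolyX (N : nat) (A : comNzRingType) (i : 'I_N) :
  free_over ('X_i : {mpoly A[N]}) (fun w => (exists c, w = c%:MP) \/
    exists2 j, j != i & w = 'X_j).
Proof.
pose h j : {poly {mpoly A[N]}} := if j == i then 'X else ('X_j)%:P.
pose psi : {rmorphism _ -> _} := mmap (polyC \o @mpolyC N A) h.
have psiX j : psi 'X_j = h j by rewrite /psi /= mmapX mmap1U.
have psiC c : psi c%:MP = (c%:MP)%:P by rewrite /psi /= mmapC.
exists psi; split=> [|b|w [[c ->]|[j ji ->]]]; last 2 first.
- exact: psiC.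
- by rewrite psiX /h (negPf ji).
- by rewrite psiX /h eqxx.
apply: (@mpoly_hom_eq N A _ (horner_eval ('X_i : {mpoly A[N]}) \o psi) idfun) => [c|j];
  rewrite /= horner_evalE ?psiC ?hornerC // psiX /h.
by case: eqP => [->|_]; rewrite ?hornerX ?hornerC.
Qed.

Lemma free_mpolyC (m : nat) (A : comNzRingType) (v : A) (W : A -> Prop) :
  free_over v W -> free_over (v%:MP : {mpoly A[m]})
    (fun w => (exists2 c, W c & w = c%:MP) \/ exists i, w = 'X_i).
Proof.
case=> psi [psiv psiK psiW].
pose h j : {poly {mpoly A[m]}} := ('X_j)%:P.
pose phi : {rmorphism _ -> _} := mmap (map_poly (@mpolyC m A) \o psi) h.
have phiX j : phi 'X_j = h j by rewrite /phi /= mmapX mmap1U.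
have phiC c : phi c%:MP = map_poly (@mpolyC m A) (psi c) by rewrite /phi /= mmapC.
exists phi; split=> [|b|w [[c Wc ->]|[j ->]]].
- by rewrite phiC psiv map_polyX.
- apply: (@mpoly_hom_eq m A _ (horner_eval (v%:MP : {mpoly A[m]}) \o phi) idfun) => [c|j];
    rewrite /= horner_evalE.
    by rewrite phiC horner_map psiK.
  by rewrite phiX hornerC.
- by rewrite phiC psiW // map_polyC.
- exact: phiX.
Qed.

Lemma free_polyC (A : comNzRingType) (v : A) (W : A -> Prop) :
  free_over v W ->
  free_over v%:P (fun w => (exists2 c, W c & w = c%:P) \/ w = 'X).
Proof.
case=> psi [psiv psiK psiW].
have [phi [phiX phiC]] : exists phi : {rmorphism {poly A} -> {poly {poly A}}},
    phi 'X = 'X%:P /\ forall c, phi c%:P = map_poly polyC (psi c).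
  exists (horner_eval ('X%:P : {poly {poly A}}) \o map_poly (map_poly polyC \o psi)).
  by split=> [|c]; rewrite /= horner_evalE ?map_polyX ?hornerX // map_polyC hornerC.
exists phi; split=> [|b|w [[c Wc ->]|->]].
- by rewrite phiC psiv map_polyX.
- apply: (@poly_hom_eq A _ (horner_eval (v%:P : {poly A}) \o phi) idfun) => [c|];
    rewrite /= horner_evalE.
    by rewrite phiC horner_map psiK.
  by rewrite phiX hornerC.
- by rewrite phiC psiW // map_polyC.
- exact: phiX.
Qed.

Lemma free_polyX (A : comNzRingType) :
  free_over ('X : {poly A}) (fun w => exists c, w = c%:P).
Proof.
exists (map_poly polyC); split=> [|b|w [c ->]].
- exact: map_polyX.
- apply: (@poly_hom_eq A _ (horner_eval ('X : {poly A}) \o map_poly polyC) idfun) => [c|];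
    rewrite /= horner_evalE.
    by rewrite map_polyC hornerC.
  by rewrite map_polyX hornerX.
- by rewrite /= map_polyC.
Qed.

(** * Powers of an ideal as values of forms *)

Lemma ideal_gen_ideal (R : comNzRingType) (G : R -> Prop) : is_ideal (ideal_gen G).
Proof.
split=> [|_ _ [s [Gs ->]] [t [Gt ->]]|r _ [s [Gs ->]]].
- by exists [::]; split=> //; rewrite big_nil.
- exists (s ++ t); split; last by rewrite big_cat.
  by move=> p; rewrite mem_cat => /orP[/Gs|/Gt].
exists [seq (r * p.1, p.2) | p <- s]; split=> [_ /mapP[p /Gs Gp ->] //|].
by rewrite big_map mulr_sumr; apply: eq_bigr => p _; rewrite mulrA.
Qed.

Lemma ideal_gen_min (R : comNzRingType) (G J : R -> Prop) f :
  is_ideal J -> (forall a, G a -> J a) -> ideal_gen G f -> J f.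
Proof.
move=> hJ GJ [s [Gs ->]]; rewrite big_seq; apply: ideal_sum => // p /Gs/GJ Jp.
exact: ideal_mull.
Qed.

Lemma mpoly_hom_congr (N : nat) (A C : comNzRingType) (J : C -> Prop)
    (e1 e2 : {rmorphism {mpoly A[N]} -> C}) :
  is_ideal J -> (forall c, J (e1 c%:MP - e2 c%:MP)) ->
  (forall i, J (e1 'X_i - e2 'X_i)) -> forall p, J (e1 p - e2 p).
Proof.
move=> hJ congC congX.
pose cg p := J (e1 p - e2 p).
have cgM p1 p2 : cg p1 -> cg p2 -> cg (p1 * p2).
  move=> c1 c2; rewrite /cg !rmorphM.
  have -> : e1 p1 * e1 p2 - e2 p1 * e2 p2
    = (e1 p1 - e2 p1) * e1 p2 + e2 p1 * (e1 p2 - e2 p2).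
    by rewrite mulrBl mulrBr addrA subrK.
  by apply: ideal_add => //; [apply: ideal_mulr | apply: ideal_mull].
elim/mpolyind => [|c al p _ _ cgp]; first by rewrite !rmorph0 subr0; case: hJ.
rewrite !rmorphD opprD addrACA; apply: ideal_add => //.
rewrite -mul_mpolyC; apply: (cgM _ _ (congC c)).
rewrite mpolyXE_id; elim/big_ind: _ => [|a b ca cb|i _]; first exact: (congC 1).
  exact: cgM.
elim: (al i) => [|l IHl]; first exact: (congC 1).
by rewrite exprS; apply: cgM.
Qed.

Section Forms.
Variables (R : comNzRingType) (m : nat) (g : 'I_m -> R) (I : R -> Prop).
Hypothesis spanI : forall f, I f <-> span predT g f.

Lemma gen_ideal : is_ideal I.
Proof.
have [S0 SD SM] := span_ideal predT g.
split=> [|a b /spanI Sa /spanI Sb|r a /spanI Sa]; apply/spanI => //; first exact: SD.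
exact: SM.
Qed.

Lemma ideal_pow_ideal k : is_ideal (ideal_pow I k).
Proof. by case: k => [|k]; [split | apply: ideal_gen_ideal]. Qed.

Lemma ideal_powS k b c : I b -> ideal_pow I k c -> ideal_pow I k.+1 (b * c).
Proof.
move=> Ib Ic; exists [:: (1, b * c)]; split; last by rewrite big_seq1 mul1r.
by move=> p; rewrite inE => /eqP -> /=; exists b, c.
Qed.

Lemma ideal_pow_le k f : ideal_pow I k.+1 f -> ideal_pow I k f.
Proof.
apply: ideal_gen_min; first exact: ideal_pow_ideal.
by move=> _ [b [c [_ Ic ->]]]; apply: ideal_mull => //; apply: ideal_pow_ideal.
Qed.

Lemma ideal_pow1 f : ideal_pow I 1 f <-> I f.
Proof.
split=> [|If]; last by rewrite -[f]mulr1; apply: ideal_powS.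
apply: ideal_gen_min; first exact: gen_ideal.
by move=> _ [b [c [Ib _ ->]]]; apply: ideal_mulr => //; apply: gen_ideal.
Qed.

Lemma monomial_pow (al : 'X_{1..m}) : ideal_pow I (mdeg al) ('X_[al].@[g]).
Proof.
move: {-1}(mdeg al) (erefl (mdeg al)) => k; elim: k al => [|k IHk] al al_k //.
have [i al_i] : exists i, (0 < al i)%N.
  apply/existsP; apply: contraT; rewrite negb_exists => /forallP al0.
  move: al_k; rewrite mdegE big1 // => i _; apply/eqP.
  by rewrite -leqn0 leqNgt al0.
have def_al : (al = (al - U_(i)) + U_(i))%MM by rewrite submK // lep1mP -lt0n.
move: al_k; rewrite def_al mdegD mdeg1 addn1 => -[/IHk Ik].
rewrite mpolyXD mevalM mulrC mevalXU; apply: ideal_powS => //.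
by apply/spanI; apply: (@span_gen _ _ predT g).
Qed.

Lemma meval_sum (F : {mpoly R[m]}) :
  F.@[g] = \sum_(al <- msupp F) F@_al * 'X_[al].@[g].
Proof. by rewrite mevalE; apply: eq_bigr => al _; rewrite mevalX. Qed.

Lemma form_pow k (F : {mpoly R[m]}) : F \is k.-homog -> ideal_pow I k (F.@[g]).
Proof.
move=> /dhomogP homF; have hIk := ideal_pow_ideal k.
rewrite meval_sum big_seq; apply: ideal_sum => // al /homF <-.
by apply: ideal_mull; [apply: ideal_pow_ideal | apply: monomial_pow].
Qed.

Lemma form_coef_pow k (F : {mpoly R[m]}) : F \is k.-homog ->
  (forall al, I F@_al) -> ideal_pow I k.+1 (F.@[g]).
Proof.
move=> /dhomogP homF IF; have hIk := ideal_pow_ideal k.+1.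
rewrite meval_sum big_seq; apply: ideal_sum => // al /homF <-.
by apply: ideal_powS => //; apply: monomial_pow.
Qed.

Lemma pow_form k f : ideal_pow I k f ->
  exists2 F : {mpoly R[m]}, F \is k.-homog & f = F.@[g].
Proof.
pose hasform k f := exists2 F : {mpoly R[m]}, F \is k.-homog & f = F.@[g].
have hF l : is_ideal (hasform l).
  split=> [|_ _ [F hF ->] [G hG ->]|r _ [F hF ->]].
  - by exists 0; rewrite ?rpred0 ?meval0.
  - by exists (F + G); rewrite ?rpredD ?mevalD.
  - by exists (r *: F); rewrite ?rpredZ ?mevalZ.
elim: k f => [|k IHk] f.
  move=> _; exists f%:MP; last by rewrite mevalC.
  by rewrite -[f%:MP]mulr1 mul_mpolyC rpredZ // dhomog1.
apply: (@ideal_gen_min _ _ (hasform k.+1) _ (hF k.+1)) => _ [b [c [/spanI[a ->] /IHk[F homF ->] ->]]].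
rewrite mulr_suml; apply: (@ideal_sum _ (hasform k.+1) _ _ _ _ (hF k.+1)) => // i _.
exists (a i *: ('X_i * F)); last by rewrite mevalZ mevalM mevalXU mulrA.
by rewrite rpredZ // -add1n dhomogM // dhomogX /= mdeg1.
Qed.

(** The generators of the ideal defining the extended Rees algebra, up to torsion with
respect to the outer variable; the inner variables stand for the elements
[- g i / u]. *)
Definition deformation (i : 'I_m) : {poly {mpoly R[m]}} :=
  ((g i)%:MP)%:P + ('X_i)%:P * 'X.

(** Modulo the deformed generators, [g i] is congruent to [- u * z_i]. *)
Lemma deformation_congr (F : {mpoly R[m]}) k : F \is k.-homog ->
  span predT deformation ((F.@[g])%:MP%:P - (- 'X) ^+ k * F%:P).
Proof.
have hJ := span_ideal predT deformation.
pose e1 : {rmorphism {mpoly R[m]} -> {poly {mpoly R[m]}}} :=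
  polyC \o (@mpolyC m R \o meval g).
pose e2 : {rmorphism {mpoly R[m]} -> {poly {mpoly R[m]}}} :=
  mmap (polyC \o @mpolyC m R) (fun i => - 'X * ('X_i)%:P).
have e12 p : span predT deformation (e1 p - e2 p).
  apply: mpoly_hom_congr => // [c|i]; rewrite /e1 /e2 /=.
    by rewrite mmapC mevalC subrr; case: hJ.
  rewrite mmapX mmap1U mevalXU mulNr opprK mulrC.
  exact: (@span_gen _ _ predT deformation i).
move=> /dhomogP homF.
suff <- : e2 F = (- 'X) ^+ k * F%:P by apply: e12.
rewrite {2}[F]mpolyE /e2 /= /mmap rmorph_sum mulr_sumr big_seq [RHS]big_seq.
apply: eq_bigr => al /homF <-.
rewrite -mul_mpolyC rmorphM mulrCA; congr (_ * _).
rewrite /mmap1; under eq_bigr do rewrite exprMn.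
rewrite big_split /= prodrXr mdegE; congr (_ * _).
by rewrite mpolyXE_id rmorph_prod; apply: eq_bigr => i _; rewrite rmorphXn.
Qed.

(** Setting the outer variable to [0]. *)
Lemma deformation_coef f al : span predT deformation f -> I (f`_0)@_al.
Proof.
case=> a ->; apply/spanI; exists (fun i => ((a i)`_0)@_al).
rewrite coef_sum raddf_sum; apply: eq_bigr => i _ /=.
rewrite coef0M coefD coefC coefMX eqxx addr0 mulrC mul_mpolyC mcoeffZ.
exact: mulrC.
Qed.

(** The element [w] annihilates the kernel of the surjection from the polynomial ring
over [R/I] to the associated graded ring of [I]. *)
Definition form_torsion (w : R) : Prop := forall k (F : {mpoly R[m]}),
  F \is k.-homog -> ideal_pow I k.+1 (F.@[g]) -> forall al, I (w * F@_al).

Lemma form_torsion_of_deformation (w : R) :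
  (forall k f, span predT deformation ('X ^+ k * f) ->
     span predT deformation ((w%:MP)%:P * f)) ->
  form_torsion w.
Proof.
move=> sat k F homF /pow_form[G homG eqFG] al.
have hJ := span_ideal predT deformation.
have : span predT deformation ('X ^+ k * (F%:P + 'X * G%:P)).
  have := ideal_sub hJ (deformation_congr homG) (deformation_congr homF).
  rewrite -eqFG => /(@ideal_mull _ _ _ ((-1) ^+ k) hJ).
  congr (span _ _ _); rewrite [(- 'X) ^+ k.+1]exprS [(- 'X) ^+ k]exprNn.
  have /= := sqrr_sign {poly {mpoly R[m]}} k; set s := (-1) ^+ k => ss.
  transitivity (s ^+ 2 * ('X ^+ k * (F%:P + 'X * G%:P))); last by rewrite ss mul1r.
  by move: (polyC F) (polyC G) (polyC _) => p q r; ring.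
move=> /sat /(@deformation_coef _ al).
by rewrite coef0M coefC eqxx coefD coefC coefXM eqxx addr0 mul_mpolyC mcoeffZ.
Qed.

End Forms.

(** * Associated primes of powers *)

(** A prime containing a finite intersection of ideals contains one of them. *)
Lemma prime_finite_meet (R : comNzRingType) (P : R -> Prop) (T : eqType)
    (s : seq T) (Q : T -> R -> Prop) :
  is_prime_ideal P -> (forall t r r', Q t r -> Q t (r' * r)) ->
  (forall r, (forall t, t \in s -> Q t r) -> P r) ->
  exists2 t, t \in s & forall r, Q t r -> P r.
Proof.
move=> [_ P1 PM] QM; elim: s => [|t s IHs] QP; first by case: P1; apply: QP.
have [[r0 [Qr0 Pr0]]|noex] := classic (exists r, Q t r /\ ~ P r); last first.
  exists t => [|r Qr]; first exact: mem_head.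
  by apply: NNPP => Pr; apply: noex; exists r.
have /IHs[t' t's QP'] : forall r, (forall t, t \in s -> Q t r) -> P r.
  move=> r Qr; suff /PM[] : P (r * r0) by [].
  apply: QP => t'; rewrite inE => /predU1P[->|/Qr]; first exact: QM.
  by rewrite mulrC; apply: QM.
by exists t' => //; rewrite inE t's orbT.
Qed.

Section AssociatedPrimes.
Variables (R : comNzRingType) (m : nat) (g : 'I_m -> R) (I : R -> Prop).
Hypothesis spanI : forall f, I f <-> span predT g f.

(** If a multiple [r * a] of the element [a] with annihilator [P] lies in [I^k] for
some [r] outside [P], then [r * a] has annihilator [P] as well; writing it as the
value of a form [F] of degree [k], the prime [P] is the intersection of the
annihilators of the [w * F@_al] modulo [I], hence one of them.  Otherwise [a] has
annihilator [P] already modulo [I^k]. *)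
Lemma assoc_prime_descend w k (P : R -> Prop) :
  form_torsion g I w -> ~ P w ->
  assoc_prime (ideal_pow I k) P -> assoc_prime I P.
Proof.
move=> torw Pw; elim: k => [|k IHk] [primeP [a Pa]].
  by case: (primeP) => _ [] //; apply/Pa.
have [_ _ PM] := primeP; have [hP _ _] := primeP.
have [[r0 [Ir0a Pr0]]|noex] := classic (exists r, ideal_pow I k (r * a) /\ ~ P r);
  last first.
  apply: IHk; split=> //; exists a => r; split=> [/Pa|Ira].
    exact: ideal_pow_le.
  by apply: NNPP => Pr; apply: noex; exists r.
have [F homF def_F] := pow_form spanI Ir0a.
have hI := gen_ideal spanI.
have PF r : (forall al, al \in msupp F -> I (w * F@_al * r)) -> P r.
  move=> IF; have : ideal_pow I k.+1 ((w * r) *: F).@[g].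
    apply: (form_coef_pow spanI); first by rewrite rpredZ.
    move=> al; rewrite mcoeffZ; have [al_F|al_F] := boolP (al \in msupp F).
      by rewrite mulrAC; apply: IF.
    by rewrite memN_msupp_eq0 // mulr0; case: hI.
  rewrite mevalZ -def_F mulrA => /Pa /PM[/PM[]|] //.
have [al alF PQ] := @prime_finite_meet _ _ _ (msupp F) (fun al r => I (w * F@_al * r))
  primeP (fun al r r' h => eq_ind_r I (ideal_mull r' hI h) (mulrCA _ _ _)) PF.
split=> //; exists (w * F@_al) => r; split=> [Pr|]; last by rewrite mulrC => /PQ.
have : ideal_pow I k.+1 (r *: F).@[g].
  rewrite mevalZ -def_F mulrCA; apply: ideal_mull; first exact: ideal_pow_ideal.
  exact/Pa.
move=> /(torw k _ _ ) -/(_ _ al); rewrite rpredZ // => /(_ isT).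
by rewrite mcoeffZ mulrCA.
Qed.

(** If [a] has annihilator [P] modulo [I], then [a * w * g_0^(k-1)] has annihilator
[P] modulo [I^k]. *)
Lemma assoc_prime_ascend w k (P : R -> Prop) : (0 < m)%N -> (0 < k)%N ->
  form_torsion g I w -> ~ P w ->
  assoc_prime I P -> assoc_prime (ideal_pow I k) P.
Proof.
case: k => // k m_gt0 _ torw Pw [primeP [a Pa]]; split=> //.
have [_ _ PM] := primeP; pose i0 := Ordinal m_gt0.
pose F : {mpoly R[m]} := 'X_i0 ^+ k.
have homF : F \is k.-homog by rewrite -[k]mul1n dhomogMn // dhomogX /= mdeg1.
exists (a * w * F.@[g]) => r; split=> [/Pa Ira|].
  have -> : r * (a * w * F.@[g]) = (r * a) * (w * F.@[g]) by ring.
  apply: ideal_powS => //; apply: ideal_mull; first exact: ideal_pow_ideal.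
  exact: (form_pow spanI).
have -> : r * (a * w * F.@[g]) = ((r * a * w) *: F).@[g] by rewrite mevalZ; ring.
have homrF : (r * a * w) *: F \is k.-homog by rewrite rpredZ.
move=> /(torw k _ homrF) /(_ (U_(i0) *+ k)%MM).
rewrite mcoeffZ mcoeffXn eqxx mulr1.
have -> : w * (r * a * w) = (w * w * r) * a by ring.
by move=> /Pa /PM[/PM[]|].
Qed.

End AssociatedPrimes.

(** * Primes containing all the y *)

Section YAdic.
Variables (R : idomainType) (m : nat) (g : 'I_m -> R) (I Yid : R -> Prop).
(* In the application [tau] multiplies each [y j] by a new variable, so that [tau r]
   collects the homogeneous components of [r] with respect to the [y j]. *)
Variable tau : {rmorphism R -> {poly R}}.
Hypothesis spanI : forall f, I f <-> span predT g f.
Hypothesis hY : is_ideal Yid.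
Hypothesis tau_const : forall r, tau (tau r).[0] = ((tau r).[0])%:P.
Hypothesis Y_sub_const : forall r, Yid (r - (tau r).[0]).
Hypothesis Y_const : forall r, Yid r -> (tau r).[0] = 0.
Hypothesis tau_g : forall i, tau (g i) = (g i)%:P * 'X.

Definition y_order_ge (k : nat) (r : R) : Prop := exists h, tau r = 'X^k * h.

Lemma Y_of_const r : (tau r).[0] = 0 -> Yid r.
Proof. by move=> r0; have := Y_sub_const r; rewrite r0 subr0. Qed.

Lemma poly_const0 (p : {poly R}) : p.[0] = 0 -> exists q, p = 'X * q.
Proof.
elim/poly_ind: p => [|p c _]; first by exists 0; rewrite mulr0.
by rewrite !hornerE => ->; exists p; rewrite addr0 mulrC.
Qed.

Lemma y_order_ideal k : is_ideal (y_order_ge k).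
Proof.
split=> [|a b [p ap] [q bq]|r a [p ap]]; first by exists 0; rewrite rmorph0 mulr0.
  by exists (p + q); rewrite rmorphD ap bq mulrDr.
by exists (tau r * p); rewrite rmorphM ap mulrCA.
Qed.

Lemma y_order_mul k r a : Yid r -> y_order_ge k a -> y_order_ge k.+1 (r * a).
Proof.
move=> /Y_const/poly_const0[q rq] [p ap].
by exists (q * p); rewrite rmorphM rq ap exprS; ring.
Qed.

Lemma gen_Y i : Yid (g i).
Proof. by apply: Y_of_const; rewrite tau_g hornerM hornerX mulr0. Qed.

Lemma pow_y_order k f : ideal_pow I k f -> y_order_ge k f.
Proof.
elim: k f => [|k IHk] f; first by exists (tau f); rewrite mul1r.
apply: ideal_gen_min; first exact: y_order_ideal.
move=> _ [b [c [Ib /IHk kc ->]]]; apply: y_order_mul => //.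
by move/spanI: Ib; apply: span_min => // i _; apply: gen_Y.
Qed.

Lemma y_order_prime k r a : y_order_ge k (r * a) -> y_order_ge k a \/ Yid r.
Proof.
have [r0|r_neq0] := eqVneq (tau r).[0] 0; first by right; apply: Y_of_const.
rewrite /y_order_ge rmorphM => -[h] eq_h; left; move: (tau a) h eq_h.
elim: k => [|k IHk] p h eq_h; first by exists p; rewrite mul1r.
have [|q def_p] := IHk p ('X * h); first by rewrite eq_h exprSr mulrA.
suff /poly_const0[q' def_q] : q.[0] = 0.
  by exists q'; rewrite def_p def_q exprSr mulrA.
have /(congr1 (horner_eval 0)) : tau r * q = 'X * h.
  apply: (@mulfI _ ('X^k)); first by rewrite -size_poly_eq0 size_polyXn.
  by rewrite mulrCA -def_p eq_h exprSr mulrA.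
rewrite !horner_evalE hornerM [in RHS]hornerM hornerX mul0r => /eqP.
by rewrite mulf_eq0 (negPf r_neq0) => /eqP.
Qed.

(** Replacing the coefficients of [F] by their values at [y = 0] gives a form whose
value at [g] is homogeneous of degree exactly [k] in the [y]'s; as [F.@[g]] has
order [k.+1], that value is [0], and it can be subtracted. *)
Lemma form_y_coef k (F : {mpoly R[m]}) : F \is k.-homog ->
  y_order_ge k.+1 (F.@[g]) ->
  exists2 G : {mpoly R[m]}, G \is k.-homog & F.@[g] = G.@[g] /\ forall al, Yid G@_al.
Proof.
move=> homF ordF.
have [rho rhoE] : exists rho : {rmorphism R -> R}, forall r, rho r = (tau r).[0].
  by exists (horner_eval 0 \o tau) => r; rewrite /= horner_evalE.
pose F0 := map_mpoly rho F.
have homF0 : F0 \is k.-homog.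
  apply/dhomogP => al; rewrite mcoeff_msupp mcoeff_map_mpoly => rho_al.
  apply: (dhomogP _ _ _ homF); rewrite mcoeff_msupp; apply: contraNneq rho_al => ->.
  exact/eqP/rmorph0.
have tauF0 : tau F0.@[g] = (F0.@[g])%:P * 'X^k.
  rewrite mevalE !rmorph_sum mulr_suml !big_seq; apply: eq_bigr => al al_F0.
  rewrite !rmorphM mcoeff_map_mpoly /= rhoE tau_const -mulrA; congr (_ * _).
  have <- : mdeg al = k by apply: (dhomogP _ _ _ homF0).
  rewrite !rmorph_prod mdegE -prodrXr -big_split /=; apply: eq_bigr => i _.
  by rewrite !rmorphXn /= tau_g exprMn.
have coefG al : Yid (F - F0)@_al.
  by rewrite mcoeffB mcoeff_map_mpoly /= rhoE.
exists (F - F0); [exact: rpredB | split=> //].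
suff F0g : F0.@[g] = 0 by rewrite mevalB F0g subr0.
have [h] : y_order_ge k.+1 F0.@[g].
  rewrite -[F0](subKr F) mevalB; apply: ideal_sub => //; first exact: y_order_ideal.
  rewrite mevalE big_seq; apply: ideal_sum; first exact: y_order_ideal.
  move=> al al_G; apply: y_order_mul => //.
  have homG : F - F0 \is k.-homog by apply: rpredB.
  have <- : mdeg al = k by apply: (dhomogP _ _ _ homG).
  exists (\prod_i (g i)%:P ^+ al i).
  rewrite rmorph_prod mdegE -prodrXr -big_split /=; apply: eq_bigr => i _.
  by rewrite rmorphXn /= tau_g exprMn mulrC.
rewrite tauF0 => /(congr1 (fun p : {poly R} => p`_k)).
by rewrite coefMXn ltnn subnn coefC eqxx coefXnM ltnSn.
Qed.

(** By induction [f] is the value of a form of degree [k], with coefficients [c] in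
[(Y)] by [form_y_coef].  Then [form_torsion] gives [w * (w * c) \in I], and both
factors [w] can be cancelled because [c] and [w * c] lie in [(Y)]. *)
Lemma y_adic_colon w k f : form_torsion g I w -> Yid w ->
  (forall c, Yid c -> I (w * c) -> I c) ->
  y_order_ge k f -> ideal_pow I k (w * f) -> ideal_pow I k f.
Proof.
move=> torw Yw colon; elim: k f => [//|k IHk] f ordf Iwf.
have ordf' : y_order_ge k f by have [h hE] := ordf; exists ('X * h); rewrite hE exprSr mulrA.
have Ikf : ideal_pow I k f by apply: IHk => //; apply: ideal_pow_le.
have [F homF def_f] := pow_form spanI Ikf.
move: ordf; rewrite {1}def_f => /(form_y_coef homF)[G homG [eqFG YG]].
rewrite def_f eqFG; apply: (form_coef_pow spanI homG) => al.
apply: (colon) => //; apply: (colon); first by rewrite mulrC; apply: ideal_mull.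
have homwG : w *: G \is k.-homog by rewrite rpredZ.
have := torw k _ homwG; rewrite mevalZ -eqFG -def_f => /(_ Iwf al).
by rewrite mcoeffZ.
Qed.

(** For the converse, [w ^+ k.-1 * D ^+ k] has order exactly [k.-1], and it is
multiplied into [I^k] by [(Y)] since [(Y) * D] lies in [I]. *)
Lemma assoc_prime_containing_Y w D k (P : R -> Prop) : (0 < k)%N ->
  form_torsion g I w ->
  (forall c, Yid c -> I (w * c) -> I c) ->
  tau w = w%:P * 'X -> w != 0 ->
  (forall r, Yid r -> I (r * D)) -> tau D = D%:P -> D != 0 ->
  (forall r, Yid r -> P r) ->
  assoc_prime (ideal_pow I k) P <-> is_prime_ideal P /\ forall r, P r <-> Yid r.
Proof.
move=> k_gt0 torw colon tau_w w_neq0 YD tau_D D_neq0 YP.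
have Yw : Yid w by apply: Y_of_const; rewrite tau_w hornerM hornerX mulr0.
split=> [[primeP [a Pa]]|[primeP PY]]; split=> //.
  move=> r; split=> [|/YP //]; rewrite Pa => /pow_y_order/y_order_prime[] // orda.
  have [_ P1 _] := primeP; case: P1; apply/Pa; rewrite mul1r.
  by apply: (y_adic_colon torw Yw colon orda); apply/Pa/YP.
case: k k_gt0 => // k _; exists (w ^+ k * D ^+ k.+1) => r; rewrite PY; split=> [Yr|].
  have -> : r * (w ^+ k * D ^+ k.+1) = (r * D) * (w * D) ^+ k by rewrite exprS exprMn; ring.
  apply: ideal_powS; first exact: YD.
  elim: k => [//|k IHk]; rewrite exprS; apply: ideal_powS => //; exact: YD.
move=> /pow_y_order[h]; rewrite !rmorphM !rmorphXn /= tau_w tau_D => eq_h.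
apply: Y_of_const.
have /(congr1 (horner_eval 0)) : tau r * (w ^+ k * D ^+ k.+1)%:P = 'X * h.
  apply: (@mulfI _ ('X^k)); first by rewrite -size_poly_eq0 size_polyXn.
  rewrite [RHS]mulrA -exprSr -eq_h polyCM !polyC_exp exprMn; ring.
rewrite !horner_evalE hornerM [in RHS]hornerM hornerX hornerC mul0r => /eqP.
by rewrite mulf_eq0 mulf_eq0 !expf_eq0 (negPf w_neq0) (negPf D_neq0) !andbF !orbF => /eqP.
Qed.

End YAdic.

(** * The deformed ideals of the two kinds of matrices *)

Lemma span_ext (B : comNzRingType) (T : finType) (P : pred T) (g h : T -> B) f :
  (forall i, P i -> g i = h i) -> span P g f -> span P h f.
Proof. by move=> gh [a ->]; exists a; apply: eq_bigr => i /gh ->. Qed.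

Section SquareDeformation.
Variables (A : comNzRingType) (n : nat) (x : 'I_n -> 'I_n -> A) (y : 'I_n -> A).

Hypothesis free_diag : forall i, free_over (x i i) (fun w => (exists j, w = y j) \/
    exists k j, (k, j) != (i, i) /\ w = x k j).
Hypothesis free_y : forall i, free_over (y i)
  (fun w => (exists2 j, j != i & w = y j) \/ exists k j, w = x k j).

Let g (i : 'I_n) : A := \sum_j x i j * y j.
Let B : comNzRingType := {poly {mpoly A[n]}}.

(* The matrix [(X | z)] and the column [(Y; u)]: the index [None] is the additional
   column, and the row [None] is filled with zeros to keep a single index type. *)
Let xB (i j : option 'I_n) : B :=
  match i, j with
  | Some i, Some j => (x i j)%:MP%:P
  | Some i, None => ('X_i)%:P
  | None, _ => 0
  end.

Let yB (j : option 'I_n) : B := if j is Some j then (y j)%:MP%:P else 'X.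

Lemma square_deformation_regular f :
  span predT (deformation g) ('X * f) -> span predT (deformation g) f.
Proof.
pose C : {set option 'I_n} := [set Some i | i in [set: 'I_n]].
have SomeC i : Some i \in C by apply: imset_f; rewrite inE.
have NoneC : None \notin C by apply/imsetP => -[].
have formE i : linear_form xB yB (None |: C) (Some i) = deformation g i.
  rewrite linear_formU1 // addrC; congr (_ + _).
  rewrite /linear_form big_imset /=; last by move=> ? ? _ _ [].
  rewrite (eq_bigl predT) => [|j]; last by rewrite inE.
  rewrite /g !rmorph_sum; apply: eq_bigr => j _; by rewrite !rmorphM.
have spanE h : span predT (deformation g) h <-> form_ideal xB yB C (None |: C) h.
  split; apply: span_min; try exact: span_ideal.
    move=> i _; rewrite -formE.
    exact: (@span_gen _ _ (fun k => k \in C) (linear_form xB yB (None |: C))).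
  by move=> _ /imsetP[i _ ->]; rewrite formE; apply: span_gen.
rewrite !spanE; apply: (@form_ideal_y_regular B _ xB yB C) => //.
- move=> _ /imsetP[i _ ->] /=.
  apply: free_overW (free_polyC (free_mpolyC n (free_diag i))) => w.
  case=> [[[j|] ->]|[k [j [/imsetP[k' _ ->] ne ->]]]]; [|by right|].
    by left; exists (y j)%:MP => //; left; exists (y j) => //; left; exists j.
  left; case: j ne => [j|] ne /=; last by exists 'X_k' => //; right; exists k'.
  exists (x k' j)%:MP => //; left; exists (x k' j) => //; right.
  by exists k', j; split.
- case=> [i|] /=.
    apply: free_overW (free_polyC (free_mpolyC n (free_y i))) => w.
    case=> [[[j|] ne ->]|[k [j [/imsetP[k' _ ->] ->]]]]; [|by right|].
      by left; exists (y j)%:MP => //; left; exists (y j) => //; left; exists j.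
    left; case: j => [j|] /=; last by exists 'X_k' => //; right; exists k'.
    by exists (x k' j)%:MP => //; left; exists (x k' j) => //; right; exists k', j.
  apply: free_overW (free_polyX {mpoly A[n]}) => w.
  case=> [[[j|] ne ->]|[k [j [/imsetP[k' _ ->] ->]]]] //; first by exists (y j)%:MP.
  by case: j => [j|] /=; [exists (x k' j)%:MP | exists 'X_k'].
Qed.

Lemma square_form_torsion (I : A -> Prop) :
  (forall f, I f <-> span predT g f) -> form_torsion g I 1.
Proof.
move=> spanI; apply: (form_torsion_of_deformation spanI) => k f.
rewrite mul1r; elim: k f => [|k IHk] f; first by rewrite mul1r.
by rewrite exprSr -mulrA => /IHk/square_deformation_regular.
Qed.

End SquareDeformation.

Section TallDeformation.
Variables (A : comNzRingType) (n : nat) (x : nat -> nat -> A) (y : nat -> A).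

Hypothesis free_x : forall i j, (i < n.+1)%N -> (j < n)%N ->
  free_over (x i j) (fun w => (exists2 l, (l < n)%N & w = y l) \/
    exists k l, [/\ (k < n.+1)%N, (l < n)%N, (k, l) != (i, j) & w = x k l]).
Hypothesis free_y : forall j, (j < n)%N ->
  free_over (y j) (fun w => (exists l, [/\ (l < n)%N, l != j & w = y l]) \/
    exists k l, [/\ (k < n.+1)%N, (l < n)%N & w = x k l]).

Let g (i : 'I_n.+1) : A := row_form x y n i.
Let B : comNzRingType := {poly {mpoly A[n.+1]}}.
(* The matrix [(X | z)] and the column [(Y; u)], with the additional column last. *)
Let xB (i j : nat) : B := if (j < n)%N then (x i j)%:MP%:P else ('X_(inord i))%:P.
Let yB (j : nat) : B := if (j < n)%N then (y j)%:MP%:P else 'X.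

Lemma tall_form_torsion (I : A -> Prop) j : (j < n)%N ->
  (forall f, I f <-> span predT g f) -> form_torsion g I (y j).
Proof.
move=> lt_jn spanI; apply: (form_torsion_of_deformation spanI) => k f.
have formE (i : 'I_n.+1) : row_form xB yB n.+1 i = deformation g i.
  rewrite row_formS /xB /yB ltnn inord_val; congr (_ + _).
  rewrite /g /row_form !rmorph_sum; apply: eq_bigr => l _.
  by rewrite ltn_ord !rmorphM.
have spanE h : span predT (deformation g) h <-> row_ideal xB yB n.+1 n.+1 h.
  by split; apply: span_ext => i _; rewrite formE.
rewrite !spanE => If; have -> : (y j)%:MP%:P = yB j by rewrite /yB lt_jn.
apply: (@row_ideal_saturation B xB yB n.+1 n.+1 _ _ n.+1 n k) => //; last 2 first.
- by rewrite /yB ltnn.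
- exact: ltnW.
- move=> i l lt_i; rewrite ltnS => lt_l.
  rewrite {1}/xB lt_l.
  apply: free_overW (free_polyC (free_mpolyC n.+1 (free_x lt_i lt_l))) => w.
  case=> [[l' lt_l' ->]|[k' [l' [lt_k' lt_l' ne ->]]]].
    rewrite /yB; case: ifP => lt_l'n; last by right.
    by left; exists (y l')%:MP => //; left; exists (y l') => //; left; exists l'.
  left; rewrite /xB; case: ifP => lt_l'n; last by exists 'X_(inord k') => //; right; eexists.
  exists (x k' l')%:MP => //; left; exists (x k' l') => //; right.
  by exists k', l'.
move=> l; rewrite ltnS leq_eqVlt => /predU1P[->|lt_l].
  rewrite {1}/yB ltnn; apply: free_overW (free_polyX {mpoly A[n.+1]}) => w.
  case=> [[l' [lt_l' ne ->]]|[k' [l' [lt_k' lt_l' ->]]]].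
    by rewrite /yB ltn_neqAle ne -ltnS lt_l'; eexists.
  by rewrite /xB; case: ifP => _; eexists.
rewrite {1}/yB lt_l.
apply: free_overW (free_polyC (free_mpolyC n.+1 (free_y lt_l))) => w.
case=> [[l' [lt_l' ne ->]]|[k' [l' [lt_k' lt_l' ->]]]].
  rewrite /yB; case: ifP => lt_l'n; last by right.
  by left; exists (y l')%:MP => //; left; exists (y l') => //; left; exists l'.
left; rewrite /xB; case: ifP => lt_l'n; last by exists 'X_(inord k') => //; right; eexists.
by exists (x k' l')%:MP => //; left; exists (x k' l') => //; right; exists k', l'.
Qed.

End TallDeformation.

(** * Normal torsionfreeness *)

Lemma I1_span (R : comNzRingType) (m n : nat) (X : 'M[R]_(m, n)) (Y : 'cV[R]_n) f :
  I1 (X *m Y) f <-> span predT (fun i => \sum_j X i j * Y j 0) f.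
Proof.
have gE i j : (X *m Y) i j = \sum_l X i l * Y l 0 by rewrite mxE ord1.
split; last first.
  apply: span_min => [|i _]; first exact: ideal_gen_ideal.
  exists [:: (1, (X *m Y) i 0)]; split; last by rewrite big_seq1 mul1r gE.
  by move=> p; rewrite inE => /eqP ->; exists i, 0.
apply: ideal_gen_min => [|_ [i [j ->]]]; first exact: span_ideal.
by rewrite gE; apply: (@span_gen _ _ predT (fun i => \sum_l X i l * Y l 0)).
Qed.

Lemma form_torsion1_normally_torsionfree (R : comNzRingType) (m : nat)
    (g : 'I_m -> R) (I : R -> Prop) :
  (0 < m)%N -> (forall f, I f <-> span predT g f) -> form_torsion g I 1 ->
  normally_torsionfree I.
Proof.
move=> m_gt0 spanI tor1 k k_gt0 P; split=> assP.
  have [[_ P1 _] _] := assP.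
  exact: (assoc_prime_ascend spanI m_gt0 k_gt0 tor1 P1).
have [[_ P1 _] _] := assP.
exact: (assoc_prime_descend spanI tor1 P1 assP).
Qed.

Section Indeterminates.
Variables (K : fieldType) (N : nat).
Local Notation R := {mpoly K[N]}.

Lemma free_indeterminate (v : 'I_N) (W : R -> Prop) :
  (forall w, W w -> exists2 u, u != v & w = 'X_u) -> free_over ('X_v : R) W.
Proof.
move=> WX; apply: free_overW (free_mpolyX K v) => w /WX[u uv ->].
by right; exists u.
Qed.

Lemma generic_square_torsionfree (n : nat) (X : 'M[R]_n) (Y : 'cV[R]_n) :
  (0 < n)%N -> generic X Y -> normally_torsionfree (I1 (X *m Y)).
Proof.
move=> n_gt0 [f [/bij_inj f_inj XE YE]].
apply: (form_torsion1_normally_torsionfree n_gt0 (I1_span X Y)).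
apply: (square_form_torsion _ _ (I1_span X Y)) => i.
  rewrite XE; apply: free_indeterminate => w [[j ->]|[k [j [ne ->]]]].
    by exists (f (inr j)); rewrite ?YE // (inj_eq f_inj).
  by exists (f (inl (k, j))); rewrite ?XE // (inj_eq f_inj).
rewrite YE; apply: free_indeterminate => w [[j ne ->]|[k [j ->]]].
  by exists (f (inr j)); rewrite ?YE // (inj_eq f_inj).
by exists (f (inl (k, j))); rewrite ?XE // (inj_eq f_inj).
Qed.

Lemma generic_symmetric_torsionfree (n : nat) (X : 'M[R]_n) (Y : 'cV[R]_n) :
  (0 < n)%N -> generic_symmetric X Y -> normally_torsionfree (I1 (X *m Y)).
Proof.
move=> n_gt0 [f [/bij_inj f_inj symX XE YE]].
have entry i j : exists p, X i j = 'X_(f (inl p)) /\ (val p = (i, j) \/ val p = (j, i)).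
  have [le_ij|/ltnW le_ji] := leqP i j.
    pose p : {p : 'I_n * 'I_n | (p.1 <= p.2)%N} := exist _ (i, j) le_ij.
    by exists p; rewrite -XE; split=> //; left.
  pose p : {p : 'I_n * 'I_n | (p.1 <= p.2)%N} := exist _ (j, i) le_ji.
  by exists p; rewrite -XE -[in LHS]symX mxE; split=> //; right.
apply: (form_torsion1_normally_torsionfree n_gt0 (I1_span X Y)).
apply: (square_form_torsion _ _ (I1_span X Y)) => i.
  have [p [-> pii]] := entry i i.
  apply: free_indeterminate => w [[j ->]|[k [j [ne ->]]]].
    by exists (f (inr j)); rewrite ?YE // (inj_eq f_inj).
  have [q [-> qkj]] := entry k j; exists (f (inl q)) => //.
  rewrite (inj_eq f_inj); apply: contraNneq ne => -[eq_qp].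
  by move: qkj; rewrite eq_qp; case: pii => -> [] [-> ->].
rewrite YE; apply: free_indeterminate => w [[j ne ->]|[k [j ->]]].
  by exists (f (inr j)); rewrite ?YE // (inj_eq f_inj).
by have [q [-> _]] := entry k j; exists (f (inl q)) => //; rewrite (inj_eq f_inj).
Qed.

(** The grading by the degree in the indeterminates of [S]; the constant coefficient
of [tau r] is [r] with these indeterminates set to [0]. *)
Lemma scaling_morphism (S : pred 'I_N) :
  exists tau : {rmorphism R -> {poly R}},
    [/\ forall v, tau 'X_v = if S v then ('X_v)%:P * 'X else ('X_v)%:P,
        forall r, tau (tau r).[0] = ((tau r).[0])%:P
      & forall J : R -> Prop, is_ideal J -> (forall v, S v -> J 'X_v) ->
          forall r, J (r - (tau r).[0])].
Proof.
pose h v : {poly R} := if S v then ('X_v)%:P * 'X else ('X_v)%:P.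
have [tau [tauC tauX]] : exists tau : {rmorphism R -> {poly R}},
    (forall c, tau c%:MP = (c%:MP)%:P) /\ forall v, tau 'X_v = h v.
  exists (mmap (polyC \o @mpolyC N K) h).
  by split=> [c|v]; rewrite /= ?mmapC // mmapX mmap1U.
exists tau; split=> [//|r|J hJ JX r].
  have := @mpoly_hom_eq N K _ (tau \o (horner_eval 0 \o tau)) (polyC \o (horner_eval 0 \o tau)).
  move=> /(_ _ _ r) /=; rewrite !horner_evalE; apply=> [c|v] /=; rewrite !horner_evalE.
    by rewrite tauC hornerC tauC.
  rewrite tauX /h; case: ifP => Sv; last by rewrite hornerC tauX /h Sv.
  by rewrite hornerM hornerX mulr0 rmorph0.
have := @mpoly_hom_congr N K _ J idfun (horner_eval 0 \o tau) hJ.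
move=> /(_ _ _ r) /=; rewrite horner_evalE; apply=> [c|v] /=; rewrite horner_evalE.
  by rewrite tauC hornerC subrr; case: hJ.
rewrite tauX /h; case: ifP => Sv; last by rewrite hornerC subrr; case: hJ.
by rewrite hornerM hornerX mulr0 subr0; apply: JX.
Qed.

(** The determinant takes the value [1] at the identity matrix. *)
Lemma det_indeterminates_neq0 (p : nat) (u : 'I_p * 'I_p -> 'I_N) : injective u ->
  \det (\matrix_(i < p, j < p) ('X_(u (i, j)) : R)) != 0.
Proof.
move=> u_inj; pose v k : K := [exists l, k == u (l, l)]%:R.
apply: contra_neq (oner_neq0 K) => D0.
rewrite -(meval0 v) -D0 -det_map_mx -(det1 K p); congr (\det _).
apply/matrixP => i j; rewrite !mxE /= mevalXU /v; congr ((nat_of_bool _)%:R).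
apply/eqP/existsP => [<-|[l]]; first by exists i.
by rewrite (inj_eq u_inj) => /eqP[-> ->].
Qed.

Lemma generic_tall_torsionfree (n : nat) (X : 'M[R]_(n.+2, n.+1)) (Y : 'cV[R]_n.+1) :
  generic X Y -> normally_torsionfree (I1 (X *m Y)).
Proof.
move=> [f [/bij_inj f_inj XE YE]].
pose x (i j : nat) : R := X (inord i) (inord j).
pose y (j : nat) : R := Y (inord j) 0.
pose I := I1 (X *m Y); pose g (i : 'I_n.+2) := row_form x y n.+1 i.
have spanI h : I h <-> span predT g h.
  rewrite /I I1_span; split; apply: span_ext => i _;
  by apply: eq_bigr => j _; rewrite /x /y !inord_val.
have xE i j : x i j = 'X_(f (inl (inord i, inord j))) by rewrite /x XE.
have yE j : y j = 'X_(f (inr (inord j))) by rewrite /y YE.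
have free_x i j : (i < n.+2)%N -> (j < n.+1)%N ->
    free_over (x i j) (fun w => (exists2 l, (l < n.+1)%N & w = y l) \/
      exists k l, [/\ (k < n.+2)%N, (l < n.+1)%N, (k, l) != (i, j) & w = x k l]).
  move=> lt_i lt_j; rewrite xE; apply: free_indeterminate => w.
  case=> [[l _ ->]|[k [l [lt_k lt_l ne ->]]]].
    by rewrite yE; eexists; last by []; rewrite (inj_eq f_inj).
  rewrite xE; eexists; last by []; rewrite (inj_eq f_inj).
  apply: contraNneq ne => -[/(congr1 (@nat_of_ord _)) + /(congr1 (@nat_of_ord _))] /=.
  by rewrite !inordK // => -> ->.
have free_y j : (j < n.+1)%N ->
    free_over (y j) (fun w => (exists l, [/\ (l < n.+1)%N, l != j & w = y l]) \/
      exists k l, [/\ (k < n.+2)%N, (l < n.+1)%N & w = x k l]).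
  move=> lt_j; rewrite yE; apply: free_indeterminate => w.
  case=> [[l [lt_l ne ->]]|[k [l [_ _ ->]]]].
    rewrite yE; eexists; last by []; rewrite (inj_eq f_inj).
    by apply: contraNneq ne => -[/(congr1 (@nat_of_ord _))] /=; rewrite !inordK // => ->.
  by rewrite xE; eexists; last by []; rewrite (inj_eq f_inj).
pose is_y v := [exists j, v == f (inr j)].
have [tau [tauX tau_const Y_retract]] := scaling_morphism is_y.
have tau_x i j : tau (x i j) = (x i j)%:P.
  by rewrite xE tauX /is_y; case: existsP => // -[l]; rewrite (inj_eq f_inj).
have tau_y j : tau (y j) = (y j)%:P * 'X.
  by rewrite yE tauX /is_y; case: existsP => // -[]; exists (inord j).
pose Yid := y_ideal y n.+1; have hY : is_ideal Yid by apply: span_ideal.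
have Y_gen (j : 'I_n.+1) : Yid (y j).
  exact: (@span_gen _ _ predT (fun j : 'I_n.+1 => y j)).
have Y_sub_const r : Yid (r - (tau r).[0]).
  apply: Y_retract => // _ /existsP[j /eqP ->].
  by rewrite -[j]inord_val -yE; apply: Y_gen.
have Y_const r : Yid r -> (tau r).[0] = 0.
  move=> [c ->]; rewrite rmorph_sum horner_sum big1 // => j _.
  by rewrite rmorphM tau_y !hornerM hornerX !mulr0.
have tau_g i : tau (g i) = (g i)%:P * 'X.
  rewrite /g /row_form !rmorph_sum mulr_suml; apply: eq_bigr => j _.
  by rewrite !rmorphM tau_x tau_y mulrA.
have torsion j : (j < n.+1)%N -> form_torsion g I (y j).
  by move=> lt_j; apply: (tall_form_torsion free_x free_y lt_j spanI).
have colon c : Yid c -> I (y n * c) -> I c.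
  move=> Yc; rewrite !spanI.
  apply: (@y_ideal_colon _ x y n.+2 n.+1 _ free_y n.+2 n) => //.
  by move=> i j lt_i lt_j; apply: free_x => //; apply: ltnW.
pose s : {ffun 'I_n.+1 -> 'I_n.+2} := [ffun i => widen_ord (leqnSn _) i].
pose D : R := \det (\matrix_(l < n.+1, j < n.+1) x (s l) j).
have tau_D : tau D = D%:P.
  rewrite /D -!det_map_mx; congr (\det _); apply/matrixP => l j.
  by rewrite !mxE tau_x.
have D_neq0 : D != 0.
  pose u (p : 'I_n.+1 * 'I_n.+1) := f (inl (widen_ord (leqnSn _) p.1, p.2)).
  have -> : D = \det (\matrix_(i < n.+1, j < n.+1) 'X_(u (i, j))).
    by congr (\det _); apply/matrixP => i j; rewrite !mxE xE ffunE !inord_val.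
  apply: det_indeterminates_neq0 => -[i j] [i' j'] /f_inj[/val_inj -> -> //].
have YD r : Yid r -> I (r * D).
  move=> [c ->]; rewrite mulr_suml; apply: ideal_sum; first exact: (gen_ideal spanI).
  move=> j _; rewrite -mulrA; apply: ideal_mull; first exact: (gen_ideal spanI).
  rewrite spanI mulrC; apply: (@minor_ideal_cramer _ x y n.+2) => //.
  exact: (@span_gen _ _ predT (@minor_gen _ x y n.+2 n.+1) (inr s)).
move=> k k_gt0 P.
have [[hP _ _]|nprimeP] := classic (is_prime_ideal P); last by split=> -[].
have [[j Pj]|YP] := classic (exists j : 'I_n.+1, ~ P (y j)).
  have torj := torsion j (ltn_ord j); split.
    exact: (assoc_prime_ascend spanI isT k_gt0 torj Pj).
  exact: (assoc_prime_descend spanI torj Pj).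
(* All the [y j] lie in [P], so [P] can only be associated to a power of [I] by being
   equal to [(Y)], and this condition is independent of the power. *)
have char l : (0 < l)%N ->
    assoc_prime (ideal_pow I l) P <-> is_prime_ideal P /\ forall r, P r <-> Yid r.
  have y_neq0 : y n != 0 by rewrite yE -msupp_eq0 msuppX.
  move=> l_gt0.
  refine (assoc_prime_containing_Y spanI hY tau_const Y_sub_const Y_const tau_g
    l_gt0 (torsion n (ltnSn n)) colon (tau_y n) y_neq0 YD tau_D D_neq0 _).
  move=> r; apply: span_min => // j _.
  by apply: NNPP => Pj; apply: YP; exists j.
have I_pow1 : assoc_prime I P <-> assoc_prime (ideal_pow I 1) P.
  split=> -[primeP [a Pa]]; split=> //; exists a => r; rewrite Pa.
    by split=> /(ideal_pow1 spanI).
  exact: ideal_pow1.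
by rewrite -/I I_pow1 !char.
Qed.

End Indeterminates.

Theorem theorem4p8 (K : fieldType) (m n N : nat)
    (hm : (0 < m)%N) (hn : (0 < n)%N)
    (X : 'M[{mpoly K[N]}]_(m, n)) (Y : 'cV[{mpoly K[N]}]_n)
    (hXY : (exists e : m = n,
              generic X Y \/ generic_symmetric (castmx (e, erefl n) X) Y)
           \/ (m = n.+1 /\ generic X Y)) :
  normally_torsionfree (I1 (X *m Y)).
Proof.
case: hXY => [[e hX]|[e hX]].
  destruct e; rewrite castmx_id in hX.
  by case: hX; [apply: generic_square_torsionfree | apply: generic_symmetric_torsionfree].
by subst m; case: n hm hn X Y hX => // n _ _ X Y; apply: generic_tall_torsionfree.
Qed.
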